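(* Let $X$ and $Y$ be cellular spaces, $X$ compact, equipped with maps $\mu\colon X\to X\vee X$ and $\nu\colon X\to X$ such that $(X,\mu,\nu;Y)$ is an admissible couple, and let $r\ge0$. Then for $\mathbf a,\mathbf b\in[X,Y]$ one has $\mathbf a\overset{r}{\approx}\mathbf b$ if and only if $\mathbf a^{-1}\mathbf b\in[X,Y]^{((r+1))}$.
   Context: Cellular space = based CW complex; maps are based. $(X,\mu,\nu;Y)$ is an admissible couple if $[X,Y]$ is a group with multiplication $[a][b]=[(a\,\bar\vee\, b)\circ\mu]$, inversion $[a]^{-1}=[a\circ\nu]$, identity the constant class ($a\,\bar\vee\, b$ restricts to $a,b$ on the wedge summands). Strong similarity: for a set $W$, $\langle W\rangle$ = free abelian group on $W$. $Y^X$ = based maps (compact-open), based at the constant map; $Y^X_a$ = path component of $a$; $V\mapsto V|_R$ restriction; $\mathcal F_n(X)$ = finite $R\subseteq X$ containing the basepoint with $|R|\le n+1$; $\langle Y^X\rangle^{(s)}=\{V: V|_R=0\ \forall R\in\mathcal F_{s-1}(X)\}$. For unbased $U,V$: $V^{(U)}$ = unbased maps; $\Xi^U(v)$ = constant map at $v$; combining product $\boxed{\sqcup}_i\langle w_i\rangle=\langle w\rangle$, $w|_{U_i}=w_i$ for $U=\coprod U_i$. For nonempty finite $E$: simplex $\Delta E$, faces $\Delta F$; layouts $A$ = sets of pairwise disjoint nonempty subsets; $\Delta[A]=\coprod_{F\in A}\Delta F$; $S$ fissile if $S|_{\Delta[A]}=\boxed{\sqcup}_{F\in A}S|_{\Delta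 F}$ for all layouts. $U\wr X=(U\times X)/(U\times\{x_0\})$, $\#^X(w)(u\wr x)=w(u)(x)$, $\langle (Y^X)^{(U)}\rangle^{(s)}_X=\langle\#^X\rangle^{-1}\langle Y^{U\wr X}\rangle^{(s)}$. $a\overset{r}{\approx}b$ iff for each nonempty finite $E$ there is a fissile $S\in\langle (Y^X_a)^{(\Delta E)}\rangle$ with $\langle\Xi^{\Delta E}(b)\rangle-S\in\langle (Y^X)^{(\Delta E)}\rangle^{(r+1)}_X$. This relation is homotopy invariant; for classes, $[a]\overset{r}{\approx}[b]$ means $a\overset{r}{\approx}b$. $[X,Y]^{((r+1))}=\{\mathbf a\in[X,Y]: 1\overset{r}{\approx}\mathbf a\}$. *)

(* Defs.v *)
From HB Require Import structures.
From mathcomp Require Import all_boot all_order all_algebra finmap.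
From mathcomp Require Import all_classical all_reals all_analysis.
From mathcomp Require Import Rstruct Rstruct_topology homotopy.

Unset Printing Implicit Defensive.

Import Order.TTheory GRing.Theory Num.Theory.
Local Open Scope classical_set_scope.
Local Open Scope ring_scope.

Notation RR := Rdefinitions.R.

(** Maps from (a subspace of) the simplex with vertex set E into Y^X, the latter
    with the compact-open topology. *)
Notation Smap E X Y := ({ptws E -> RR} -> @compact_open X Y).

Definition sqnorm {n : nat} (v : 'rV[RR]_n) : RR := \sum_(i < n) (v ord0 i) ^+ 2.
Definition disk (n : nat) : set 'rV[RR]_n := [set v | sqnorm v <= 1].
Definition odisk (n : nat) : set 'rV[RR]_n := [set v | sqnorm v < 1].
Definition sphere (n : nat) : set 'rV[RR]_n := [set v | sqnorm v = 1].
Arguments disk n : clear implicits.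
Arguments odisk n : clear implicits.
Arguments sphere n : clear implicits.

Definition is_based_CW (X : topologicalType) (x0 : X) : Prop :=
  hausdorff_space X /\
  exists (I : Type) (dim : I -> nat) (Phi : forall i, 'rV[RR]_(dim i) -> X),
    [/\ forall i, {within disk (dim i), continuous Phi i},
        forall x : X, exists! i, exists2 v, odisk (dim i) v & Phi i v = x &
        forall i (u v : 'rV[RR]_(dim i)), odisk _ u -> odisk _ v ->
          Phi i u = Phi i v -> u = v] /\
    [/\
        forall i (U : set 'rV[RR]_(dim i)), open U ->
          exists O : set X, open O /\
            O `&` (Phi i @` odisk (dim i)) = Phi i @` (U `&` odisk (dim i)),
        forall i, exists J : set I, [/\ finite_set J,
          forall j, J j -> (dim j < dim i)%N &
          Phi i @` sphere (dim i) `<=` \bigcup_(j in J) (Phi j @` odisk (dim j))],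
        forall A : set X,
          closed A <-> forall i, closed (disk (dim i) `&` Phi i @^-1` A) &
        exists i (v : 'rV[RR]_(dim i)), dim i = 0%N /\ Phi i v = x0].

Definition bmap {X Y : topologicalType} (x0 : X) (y0 : Y) : set (X -> Y) :=
  [set f | continuous f /\ f x0 = y0].

Definition unit_interval : set RR := [set t | 0 <= t <= 1].

Definition bhomotopic {X Y : topologicalType} (x0 : X) (y0 : Y) (a b : X -> Y)
  : Prop :=
  exists H : X * RR -> Y,
    [/\ {within [set: X] `*` unit_interval, continuous H},
        forall x, H (x, 0) = a x,
        forall x, H (x, 1) = b x &
        forall t, unit_interval t -> H (x0, t) = y0].

(** The wedge X v X (summand [true] is the first one, [false] the second). *)
Definition wedge2 {X : topologicalType} (x0 : X) :=
  @wedge bool (fun _ : bool => X) (fun _ => x0).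
Definition wedge2_pt {X : topologicalType} (x0 : X) : wedge2 x0 :=
  @wedge_lift bool (fun _ : bool => X) (fun _ => x0) true x0.

Definition wsum {X Y : topologicalType} (x0 : X) (a b : X -> Y) : wedge2 x0 -> Y :=
  @wedge_fun bool (fun _ : bool => X) (fun _ => x0) Y
    (fun i : bool => if i then a else b).

Definition mulm {X Y : topologicalType} {x0 : X} (mu : X -> wedge2 x0)
  (a b : X -> Y) : X -> Y := wsum x0 a b \o mu.

(** (X, mu, nu; Y) is an admissible couple: mu, nu are based maps and
    [X,Y] is a group with product [a][b] = [(a \bar\vee b) o mu],
    inverse [a]^-1 = [a o nu] and unit the class of the constant map. *)
Definition admissible {X Y : topologicalType} (x0 : X) (y0 : Y)
  (mu : X -> wedge2 x0) (nu : X -> X) : Prop :=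
  [/\ continuous mu /\ mu x0 = wedge2_pt x0,
      continuous nu /\ nu x0 = x0 &
      forall a b c, bmap x0 y0 a -> bmap x0 y0 b -> bmap x0 y0 c ->
      [/\ bhomotopic x0 y0 (mulm mu (mulm mu a b) c) (mulm mu a (mulm mu b c)),
          bhomotopic x0 y0 (mulm mu (fun _ => y0) a) a,
          bhomotopic x0 y0 (mulm mu a (fun _ => y0)) a,
          bhomotopic x0 y0 (mulm mu (a \o nu) a) (fun _ => y0) &
          bhomotopic x0 y0 (mulm mu a (a \o nu)) (fun _ => y0)]].

(** * Free abelian groups, encoded by finitely supported coefficients  *)

Definition fsupp {W : choiceType} (c : W -> int) : set W := [set w | c w != 0].

Definition freeab {W : choiceType} (S : set W) : set (W -> int) :=
  [set c | finite_set (fsupp c) /\ fsupp c `<=` S].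

Definition push {W W' : choiceType} (f : W -> W') (c : W -> int) : W' -> int :=
  fun w' => (\sum_(w \in fsupp c `&` (f @^-1` [set w'])) c w)%R.

Definition gen {W : choiceType} (w : W) : W -> int :=
  fun v => if `[< v = w >] then 1 else 0.

Definition simplex (E : finType) : set {ptws E -> RR} :=
  [set t | (forall e, 0 <= t e) /\ \sum_(e : E) t e = 1].

Definition face {E : finType} (F : {set E}) : set {ptws E -> RR} :=
  [set t | simplex E t /\ forall e, e \notin F -> t e = 0].

Definition layout {E : finType} (A : {set {set E}}) : Prop :=
  (forall F, F \in A -> F != finset.set0) /\
  (forall F G, F \in A -> G \in A -> F != G -> F :&: G = finset.set0).

(** Delta[A] = coproduct of the faces Delta F, F in A; for a layout these
    faces are pairwise disjoint closed subsets of Delta E, so we realise the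
    coproduct as their union inside Delta E. *)
Definition layout_space {E : finType} (A : {set {set E}}) : set {ptws E -> RR} :=
  [set t | exists2 F, F \in A & face F t].

(** Y^X carries the compact-open topology. An (unbased, continuous) map
    w : U -> C, for U a subset of the simplex and C a subset of Y^X, is encoded
    as a function on the whole ambient space which equals the constant map
    (the base point of Y^X) outside U. *)
Definition maps_on {E : finType} {X Y : topologicalType} (y0 : Y)
  (U : set {ptws E -> RR}) (C : set (X -> Y))
  : set (Smap E X Y) :=
  [set g : Smap E X Y | [/\ {within U, continuous g},
               forall t, U t -> C (g t : X -> Y) &
               forall t, ~ U t -> g t = (fun _ => y0)]].

Definition restr {E : finType} {X Y : topologicalType} (y0 : Y)
  (U' : set {ptws E -> RR}) (g : Smap E X Y)
  : Smap E X Y :=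
  fun t => if `[< U' t >] then g t else (fun _ => y0).

Definition Xi {E : finType} {X Y : topologicalType} (y0 : Y) (b : X -> Y)
  : Smap E X Y :=
  fun t => if `[< simplex E t >] then b else (fun _ => y0).

Definition pcomp {X Y : topologicalType} (x0 : X) (y0 : Y) (a : X -> Y)
  : set (X -> Y) :=
  [set b | exists gam : RR -> {compact-open, X -> Y},
     [/\ {within unit_interval, continuous gam},
         forall t, unit_interval t -> bmap x0 y0 (gam t),
         gam 0 = a & gam 1 = b]].

(** Combining product: for c_F in <(Y^X)^(Delta F)>, F in A, the coefficient of
    boxed-sqcup_{F in A} c_F at w : Delta[A] -> Y^X is prod_F c_F(w|_{Delta F}). *)
Definition comb {E : finType} {X Y : topologicalType} (y0 : Y)
  (A : {set {set E}})
  (c : {set E} -> (Smap E X Y) -> int)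
  : (Smap E X Y) -> int :=
  fun g => if `[< g = restr y0 (layout_space A) g >]
           then (\prod_(F in A) c F (restr y0 (face F) g))%R else 0.

Definition fissile {E : finType} {X Y : topologicalType} (y0 : Y)
  (S : (Smap E X Y) -> int) : Prop :=
  forall A : {set {set E}}, layout A ->
    push (restr y0 (layout_space A)) S =
    comb y0 A (fun F => push (restr y0 (face F)) S).

(** <(Y^X)^(Delta E)>^(r+1)_X = <#^X>^{-1} <Y^{Delta E wr X}>^(r+1).
    A finite set of points of Delta E wr X = (Delta E x X)/(Delta E x {x0})
    containing the base point and of cardinality <= r+1 is encoded by the finite
    set R of its non-base points, i.e. pairs (t, x) with t in Delta E and
    x <> x0, with #|R| <= r.  The restriction of #^X(w) to it is encoded by
    the function equal to w(t)(x) on R and to the base point y0 elsewhere. *)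
Definition wr_restr {E : finType} {X Y : topologicalType} (y0 : Y)
  (R : {fset ({ptws E -> RR} * X)}) (g : Smap E X Y)
  : {ptws E -> RR} * X -> Y :=
  fun p => if p \in R then g p.1 p.2 else y0.

Definition filt_wr {E : finType} {X Y : topologicalType} (x0 : X) (y0 : Y)
  (r : nat) : set ((Smap E X Y) -> int) :=
  [set V | freeab (maps_on y0 (simplex E) (bmap x0 y0)) V /\
     forall R : {fset ({ptws E -> RR} * X)},
       (forall p, p \in R -> simplex E p.1 /\ p.2 != x0) ->
       (#|` R | <= r)%N ->
       push (wr_restr y0 R) V = (fun _ => 0)].

Definition strong_sim {X Y : topologicalType} (x0 : X) (y0 : Y) (r : nat)
  (a b : X -> Y) : Prop :=
  forall E : finType, (0 < #|E|)%N ->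
    exists S : (Smap E X Y) -> int,
      [/\ freeab (maps_on y0 (simplex E) (pcomp x0 y0 a)) S,
          fissile y0 S &
          filt_wr x0 y0 r (fun g => gen (Xi y0 b) g - S g)].

(* Main.v *)
Require Import Defs.
From HB Require Import structures.
From mathcomp Require Import all_boot all_order all_algebra finmap.
From mathcomp Require Import all_classical all_reals all_analysis.
From mathcomp Require Import Rstruct Rstruct_topology homotopy.
From mathcomp Require Import ring lra.
Import Order.TTheory GRing.Theory Num.Theory.
Local Open Scope classical_set_scope.
Local Open Scope ring_scope.
Set Implicit Arguments.
Unset Strict Implicit.

(** A local operator [f |-> (x |-> k x (f (phi x)))] acts on formal combinations
    of maps, preserves fissility, and does not lower the filtration, since the
    restriction of the image of [f] to a finite set is determined by the
    restriction of [f] to a set that is not larger.  Left multiplication by a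
    fixed map is such an operator, so [a ~ b] gives [ca ~ cb]; with [c = a^-1],
    and back with [c = a], the theorem follows from the homotopy invariance of
    the relation.  Invariance in the first argument is immediate.  In the second
    one, a homotopy from [b] to [b'] has to be realised by a local operator
    [k x y] with [k x (b x) = b' x]: near the graph of [b], move [y] to [b x] and
    follow the homotopy, and switch this motion off away from the graph.  Moving
    [y] to [b x] needs a homotopy between the two projections on a neighbourhood
    of the diagonal of a finite subcomplex of [Y].  It is built cell by cell:
    inside the new cell one moves along segments; near its boundary one pushes
    both points out radially and uses the homotopy of the smaller complex. *)

(** * Continuity on a subset *)

Definition ctsOn {T U : topologicalType} (A : set T) (f : T -> U) :=
  forall x, A x -> f @ within A (nbhs x) --> f x.

Section ctsOn_theory.
Context {T U : topologicalType}.
Implicit Types (A B : set T).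

Lemma ctsOnP A (f : T -> U) : {within A, continuous f} <-> ctsOn A f.
Proof. exact: subspace_continuousP. Qed.

Lemma continuous_ctsOn A (f : T -> U) : continuous f -> ctsOn A f.
Proof. by move=> cf; apply/ctsOnP/continuous_subspaceT. Qed.

Lemma ctsOnT (f : T -> U) : ctsOn setT f -> continuous f.
Proof. by move=> /ctsOnP cf; apply/continuous_subspace_setT. Qed.

Lemma ctsOnW A B (f : T -> U) : A `<=` B -> ctsOn B f -> ctsOn A f.
Proof. by move=> AB /ctsOnP cf; apply/ctsOnP/(continuous_subspaceW AB). Qed.

Lemma eq_ctsOn A (f g : T -> U) : {in A, f =1 g} -> ctsOn A f -> ctsOn A g.
Proof.
by move=> fg /ctsOnP cf; apply/ctsOnP; exact: subspace_eq_continuous fg cf.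
Qed.

Lemma ctsOn_cst A (y : U) : ctsOn A (fun=> y).
Proof. by apply: continuous_ctsOn => x; exact: cvg_cst. Qed.

End ctsOn_theory.

Lemma ctsOn_id {T : topologicalType} (A : set T) : ctsOn A id.
Proof. by apply: continuous_ctsOn => x; exact: cvg_id. Qed.

Lemma ctsOn_comp {T U V : topologicalType} (A : set T) (B : set U)
    (f : T -> U) (g : U -> V) :
  ctsOn A f -> ctsOn B g -> (forall x, A x -> B (f x)) ->
  ctsOn A (fun x => g (f x)).
Proof.
move=> cf cg AB x Ax; apply: cvg_comp (cg _ (AB _ Ax)) => P /= fP.
have /= := cf x Ax _ fP; rewrite !nbhs_simpl/= /within/=.
by apply: filterS => y Py Ay; apply: Py Ay (AB _ Ay).
Qed.

Lemma ctsOn_compT {T U V : topologicalType} (A : set T) (f : T -> U) (g : U -> V) :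
  ctsOn A f -> continuous g -> ctsOn A (fun x => g (f x)).
Proof.
by move=> cf cg; apply: (@ctsOn_comp _ _ _ _ setT) => //; exact: continuous_ctsOn.
Qed.

Lemma ctsOn_pair {T U V : topologicalType} (A : set T) (f : T -> U) (g : T -> V) :
  ctsOn A f -> ctsOn A g -> ctsOn A (fun x => (f x, g x)).
Proof. by move=> cf cg x Ax; apply: cvg_pair; [exact: cf|exact: cg]. Qed.

Lemma ctsOn2 {T U V W : topologicalType} (A : set T)
    (f : T -> U) (g : T -> V) (h : U -> V -> W) :
  continuous (fun p => h p.1 p.2) ->
  ctsOn A f -> ctsOn A g -> ctsOn A (fun x => h (f x) (g x)).
Proof.
move=> ch cf cg.
exact: (@ctsOn_compT _ _ _ _ _ (fun p => h p.1 p.2) (ctsOn_pair cf cg)).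
Qed.

Section ctsOn_sets.
Context {T U : topologicalType}.
Implicit Types (A B : set T).

Lemma ctsOn_setU A B (f : T -> U) : closed A -> closed B ->
  ctsOn A f -> ctsOn B f -> ctsOn (A `|` B) f.
Proof.
by move=> cA cB /ctsOnP fA /ctsOnP fB; apply/ctsOnP/withinU_continuous.
Qed.

Lemma ctsOn_compact A (f : T -> U) : ctsOn A f -> compact A -> compact (f @` A).
Proof. by move=> /ctsOnP; exact: continuous_compact. Qed.

End ctsOn_sets.

Arguments ctsOn_comp {T U V} A B f g.
Arguments ctsOn_compT {T U V} A f g.
Arguments ctsOn2 {T U V W} A f g h.

Lemma ctsOn_fst {T U V : topologicalType} (A : set T) (f : T -> U * V) :
  ctsOn A f -> ctsOn A (fun x => (f x).1).
Proof. by move=> cf; apply: (ctsOn_compT _ _ fst) => // x; exact: cvg_fst. Qed.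

Lemma ctsOn_snd {T U V : topologicalType} (A : set T) (f : T -> U * V) :
  ctsOn A f -> ctsOn A (fun x => (f x).2).
Proof. by move=> cf; apply: (ctsOn_compT _ _ snd) => // x; exact: cvg_snd. Qed.

Section ctsOn_real.
Context {T : topologicalType}.
Implicit Types (A : set T) (f g : T -> RR).

Lemma ctsOnD A f g : ctsOn A f -> ctsOn A g -> ctsOn A (fun x => f x + g x).
Proof. by move=> cf cg x Ax; apply: (@cvgD RR RR^o); [exact: cf|exact: cg]. Qed.

Lemma ctsOnB A f g : ctsOn A f -> ctsOn A g -> ctsOn A (fun x => f x - g x).
Proof. by move=> cf cg x Ax; apply: (@cvgB RR RR^o); [exact: cf|exact: cg]. Qed.

Lemma ctsOnM A f g : ctsOn A f -> ctsOn A g -> ctsOn A (fun x => f x * g x).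
Proof. by move=> cf cg x Ax; apply: (@cvgM RR); [exact: cf|exact: cg]. Qed.

Lemma ctsOnV A f : (forall x, A x -> f x != 0) -> ctsOn A f ->
  ctsOn A (fun x => (f x)^-1).
Proof. by move=> f0 cf x Ax; apply: (@cvgV RR); [exact: f0|exact: cf]. Qed.

Lemma ctsOn_norm A f : ctsOn A f -> ctsOn A (fun x => `|f x|).
Proof. by move=> cf x Ax; apply: (@cvg_norm RR RR^o); exact: cf. Qed.

Lemma ctsOn_max A f g : ctsOn A f -> ctsOn A g ->
  ctsOn A (fun x => Num.max (f x) (g x)).
Proof.
move=> cf cg; apply: (ctsOn2 _ _ _ (fun a b : RR => Num.max a b)) => //= x.
by apply: (@continuous_max RR (RR * RR)%type fst snd);
  [exact: cvg_fst|exact: cvg_snd].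
Qed.

Lemma ctsOn_min A f g : ctsOn A f -> ctsOn A g ->
  ctsOn A (fun x => Num.min (f x) (g x)).
Proof.
move=> cf cg; apply: (ctsOn2 _ _ _ (fun a b : RR => Num.min a b)) => //= x.
by apply: (@continuous_min RR (RR * RR)%type fst snd);
  [exact: cvg_fst|exact: cvg_snd].
Qed.

Lemma ctsOn_sqrt A f : ctsOn A f -> ctsOn A (fun x => Num.sqrt (f x)).
Proof.
move=> cf; apply: (ctsOn_compT _ _ (@Num.sqrt RR)) => //.
exact: sqrt_continuous.
Qed.

Lemma ctsOn_mxZ n A f (g : T -> 'rV[RR]_n) : ctsOn A f -> ctsOn A g ->
  ctsOn A (fun x => f x *: g x).
Proof. by move=> cf cg x Ax; apply: (@cvgZ RR 'rV[RR]_n); [exact: cf|exact: cg]. Qed.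

Lemma ctsOn_mxD n A (f g : T -> 'rV[RR]_n) : ctsOn A f -> ctsOn A g ->
  ctsOn A (fun x => f x + g x).
Proof. by move=> cf cg x Ax; apply: (@cvgD RR 'rV[RR]_n); [exact: cf|exact: cg]. Qed.

Lemma ctsOn_mxB n A (f g : T -> 'rV[RR]_n) : ctsOn A f -> ctsOn A g ->
  ctsOn A (fun x => f x - g x).
Proof. by move=> cf cg x Ax; apply: (@cvgB RR 'rV[RR]_n); [exact: cf|exact: cg]. Qed.

Lemma ctsOn_sum I (r : seq I) A (F : I -> T -> RR) :
  (forall i, ctsOn A (F i)) -> ctsOn A (fun x => \sum_(i <- r) F i x : RR).
Proof.
move=> cF; elim: r => [|i r IHr].
  by apply: eq_ctsOn (@ctsOn_cst _ _ A (0 : RR)) => x _; rewrite big_nil.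
by apply: eq_ctsOn (ctsOnD (cF i) IHr) => x _; rewrite big_cons.
Qed.

Lemma ctsOn_sqnorm n A (g : T -> 'rV[RR]_n) : ctsOn A g ->
  ctsOn A (fun x => sqnorm (g x)).
Proof.
move=> cg; apply: ctsOn_sum => i; apply: ctsOnM;
  by apply: (ctsOn_compT _ _ (fun v : 'rV[RR]_n => v ord0 i)) => //;
     exact: coord_continuous.
Qed.

End ctsOn_real.

Section ctsOn_glue.
Context {T U : topologicalType}.

Lemma nbhs_within_closedN {R : topologicalType} (S : set T) (g : T -> R)
    (C : set R) x : ctsOn S g -> closed C -> S x -> ~ C (g x) ->
  \forall y \near x, S y -> ~ C (g y).
Proof.
move=> cg cC Sx Cgx; have /= := cg x Sx (~` C).
rewrite !nbhs_simpl/= /within/=; apply.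
by apply: open_nbhs_nbhs; split => //; exact: closed_openC.
Qed.

(* The two closed pieces of [S] are given as preimages so that they only need
   to be closed relative to [S]. *)
Lemma ctsOn_glue {R : topologicalType} (S : set T) (g : T -> R) (C D : set R)
    (f : T -> U) : ctsOn S g -> closed C -> closed D ->
  (forall x, S x -> C (g x) \/ D (g x)) ->
  ctsOn (S `&` g @^-1` C) f -> ctsOn (S `&` g @^-1` D) f -> ctsOn S f.
Proof.
move=> cg cC cD SCD fC fD x Sx P Pfx; rewrite !nbhs_simpl/= /within/=.
have HC : \forall y \near x, S y -> C (g y) -> P (f y).
  have [Cx|NCx] := pselect (C (g x)).
    have /= := fC x (conj Sx Cx) P Pfx; rewrite !nbhs_simpl/= /within/=.
    by apply: filterS => y Py Sy Cy; exact: Py.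
  have := nbhs_within_closedN cg cC Sx NCx.
  by apply: filterS => y NC Sy Cy; case: (NC Sy Cy).
have HD : \forall y \near x, S y -> D (g y) -> P (f y).
  have [Cx|NCx] := pselect (D (g x)).
    have /= := fD x (conj Sx Cx) P Pfx; rewrite !nbhs_simpl/= /within/=.
    by apply: filterS => y Py Sy Cy; exact: Py.
  have := nbhs_within_closedN cg cD Sx NCx.
  by apply: filterS => y NC Sy Cy; case: (NC Sy Cy).
apply: filterS2 HC HD => y hC hD Sy.
by have [] := SCD y Sy; [exact: hC|exact: hD].
Qed.

Lemma ctsOn_if (S : set T) (g h : T -> RR) (f1 f2 : T -> U) :
  ctsOn S g -> ctsOn S h ->
  ctsOn (S `&` [set x | g x <= h x]) f1 ->
  ctsOn (S `&` [set x | h x <= g x]) f2 ->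
  (forall x, S x -> g x = h x -> f1 x = f2 x) ->
  ctsOn S (fun x => if g x <= h x then f1 x else f2 x).
Proof.
move=> cg ch c1 c2 f12.
apply: (@ctsOn_glue RR S (fun x => g x - h x) [set t | t <= 0] [set t | 0 <= t]).
- exact: ctsOnB.
- exact: closed_le.
- exact: closed_ge.
- by move=> x _ /=; case: (leP (g x - h x) 0) => [|/ltW]; [left|right].
- apply: (@eq_ctsOn _ _ _ f1); last first.
    by apply: ctsOnW c1 => x [Sx]; rewrite /= subr_le0.
  by move=> x; rewrite inE => -[_]; rewrite /= subr_le0 => ->.
- apply: (@eq_ctsOn _ _ _ f2); last first.
    by apply: ctsOnW c2 => x [Sx]; rewrite /= subr_ge0.
  move=> x; rewrite inE => -[Sx]; rewrite /= subr_ge0 => hg.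
  by case: ifPn => // gh; rewrite f12 //; apply/eqP; rewrite eq_le gh hg.
Qed.

(** A continuous map from a compact set to a Hausdorff space is closed: the points of [A] that [f]
    after [p] sends outside a given open set form a compact set, and its image is closed. *)
Lemma ctsOn_quotient {Q : topologicalType} (A : set T) (p : T -> U) (f : U -> Q) :
  hausdorff_space U -> compact A -> ctsOn A p -> ctsOn A (fun x => f (p x)) ->
  ctsOn (p @` A) f.
Proof.
move=> hU cA cp cfp y _ P; rewrite nbhsE => -[ O [oO Oy] OP].
rewrite !nbhs_simpl/= /within/=.
set B := A `&` [set x | ~ O (f (p x))].
have cB : compact B.
  apply/compact_near_coveringP/near_covering_withinP => I F G FF H.
  have NC : near_covering_within A.
    by apply/near_covering_withinP; apply/compact_near_coveringP.
  apply: filterS (NC I F (fun i x => B x -> G i x) FF _) => [i h x Bx|x Ax].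
    by apply: h => //; case: Bx.
  have [Ofx|NOfx] := pselect (O (f (p x))).
    have /= := cfp x Ax O (open_nbhs_nbhs (conj oO Ofx)).
    rewrite !nbhs_simpl/= /within/= => HO.
    exists ([set z | A z -> O (f (p z))], setT) => /=.
      by split => //; exact: filterT.
    by move=> [z i] /= [AO _] Az [_]; case; exact: AO.
  by have := H x (conj Ax NOfx); apply: filterS => -[z i] /= h Az Bz; exact: h.
have : closed (p @` B).
  apply: compact_closed => //; apply: ctsOn_compact => //.
  by apply: ctsOnW cp; exact: subIsetl.
move=> /closed_openC oB; have : nbhs y (~` (p @` B)).
  apply: open_nbhs_nbhs; split => // -[x [Ax NO] pxy].
  by apply: NO; rewrite pxy.
apply: filterS => z NB [x Ax pxz]; apply: OP.
by apply: contrapT => NO; apply: NB; exists x => //; split => //=; rewrite pxz.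
Qed.

End ctsOn_glue.

(** * Cutoffs and homotopies on a subset *)

Definition clamp (t : RR) : RR := Num.max 0 (Num.min 1 t).

Lemma clamp_itv t : 0 <= clamp t <= 1.
Proof. by rewrite /clamp le_max lexx /= ge_max ler01 ge_min lexx. Qed.

Lemma clamp_eq1 t : 1 <= t -> clamp t = 1.
Proof. by move=> t1; rewrite /clamp min_l // max_r. Qed.

Lemma clamp_eq0 t : t <= 0 -> clamp t = 0.
Proof.
by move=> t0; rewrite /clamp min_r ?max_l //; apply: le_trans t0 ler01.
Qed.

Lemma ctsOn_clamp {T : topologicalType} (A : set T) (f : T -> RR) :
  ctsOn A f -> ctsOn A (fun x => clamp (f x)).
Proof.
move=> cf; apply: ctsOn_max; first exact: ctsOn_cst.
by apply: ctsOn_min => //; exact: ctsOn_cst.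
Qed.

Lemma ctsOn_cstM {T : topologicalType} (A : set T) (c : RR) (f : T -> RR) :
  ctsOn A f -> ctsOn A (fun x => c * f x).
Proof. by move=> cf; apply: ctsOnM => //; exact: ctsOn_cst. Qed.

Lemma ctsOn_cstB {T : topologicalType} (A : set T) (c : RR) (f : T -> RR) :
  ctsOn A f -> ctsOn A (fun x => c - f x).
Proof. by move=> cf; apply: ctsOnB => //; exact: ctsOn_cst. Qed.

Lemma ctsOn_Bcst {T : topologicalType} (A : set T) (c : RR) (f : T -> RR) :
  ctsOn A f -> ctsOn A (fun x => f x - c).
Proof. by move=> cf; apply: ctsOnB => //; exact: ctsOn_cst. Qed.

(** The base point condition on [B] lets this cover both based homotopies ([S] everything, [B] the
    base point) and homotopies between the projections near a diagonal. *)
Definition homot {T Y : topologicalType} (y0 : Y) (S B : set T) (f g : T -> Y) :=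
  exists H : T * RR -> Y,
    [/\ ctsOn (S `*` unit_interval) H, forall p, S p -> H (p, 0) = f p,
        forall p, S p -> H (p, 1) = g p &
        forall p t, B p -> unit_interval t -> H (p, t) = y0].

Section homot_theory.
Context {T Y : topologicalType} (y0 : Y).
Implicit Types (S B : set T).

Lemma homot_trans S B (f g h : T -> Y) :
  homot y0 S B f g -> homot y0 S B g h -> homot y0 S B f h.
Proof.
move=> [H1 [c1 H10 H11 B1]] [H2 [c2 H20 H21 B2]].
exists (fun q : T * RR => if q.2 <= 2^-1 then H1 (q.1, 2 * q.2) else H2 (q.1, 2 * q.2 - 1)).
split.
- apply: ctsOn_if.
  + by apply: ctsOn_snd; exact: ctsOn_id.
  + exact: ctsOn_cst.
  + apply: (ctsOn_comp _ (S `*` unit_interval) (fun q : T * RR => (q.1, 2 * q.2)) H1) => //.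
      apply: ctsOn_pair; first by apply: ctsOn_fst; exact: ctsOn_id.
      by apply: ctsOn_cstM; apply: ctsOn_snd; exact: ctsOn_id.
    by move=> [p t] [[/= Sp /andP[t0 t1] t2]]; split => //=; apply/andP; split; lra.
  + apply: (ctsOn_comp _ (S `*` unit_interval) (fun q : T * RR => (q.1, 2 * q.2 - 1)) H2) => //.
      apply: ctsOn_pair; first by apply: ctsOn_fst; exact: ctsOn_id.
      by apply: ctsOn_Bcst; apply: ctsOn_cstM; apply: ctsOn_snd; exact: ctsOn_id.
    by move=> [p t] [[/= Sp /andP[t0 t1] t2]]; split => //=; apply/andP; split; lra.
  + move=> [p t] [/= Sp _] ->; rewrite (_ : 2 * 2^-1 = 1); last by lra.
    by rewrite H11 // subrr H20.
- by move=> p Sp /=; rewrite invr_ge0 ler0n mulr0 H10.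
- move=> p Sp /=; rewrite ifF; last by apply/negbTE; rewrite -ltNge; lra.
  by rewrite (_ : 2 * 1 - 1 = 1) ?H21 //; lra.
- move=> p t Bp /andP[t0 t1] /=; case: ifPn => [t2|]; last rewrite -ltNge => t2.
    by apply: B1 => //; apply/andP; split; lra.
  by apply: B2 => //; apply/andP; split; lra.
Qed.

End homot_theory.

Lemma homot_comp {T T' Y : topologicalType} (y0 : Y) (S B : set T)
    (S' B' : set T') (phi : T' -> T) (f g : T -> Y) :
  ctsOn S' phi -> (forall x, S' x -> S (phi x)) ->
  (forall x, B' x -> B (phi x)) -> homot y0 S B f g ->
  homot y0 S' B' (fun x => f (phi x)) (fun x => g (phi x)).
Proof.
move=> cphi phiS phiB [H [cH H0 H1 HB]].
exists (fun q : T' * RR => H (phi q.1, q.2)); split.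
- apply: (ctsOn_comp _ (S `*` unit_interval) (fun q : T' * RR => (phi q.1, q.2)) H) => //.
    apply: ctsOn_pair; last by apply: ctsOn_snd; exact: ctsOn_id.
    apply: (ctsOn_comp _ S' _ phi) => //; last by move=> x [].
    by apply: ctsOn_fst; exact: ctsOn_id.
  by move=> q [? ?]; split => //; exact: phiS.
- by move=> p Sp; rewrite H0 //; exact: phiS.
- by move=> p Sp; rewrite H1 //; exact: phiS.
- by move=> p t Bp; apply: HB; exact: phiB.
Qed.

(* Weaker than local equiconnectedness of [L]: the homotopy need not be constant
   on the diagonal, except at the base point. *)
Definition proj_homotopic {Y : topologicalType} (y0 : Y) (L : set Y) :=
  exists eps : Y * Y -> RR,
    [/\ ctsOn (L `*` L) eps, forall y, L y -> eps (y, y) = 0 &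
        homot y0 ((L `*` L) `&` [set p | eps p < 1])
          [set p | L y0 /\ p = (y0, y0)] fst snd].

(** * Euclidean disks *)

Section sqnorm_theory.
Context {n : nat}.
Implicit Types (u v : 'rV[RR]_n).

Lemma sqnormZ a v : sqnorm (a *: v) = a ^+ 2 * sqnorm v.
Proof.
by rewrite /sqnorm mulr_sumr; apply: eq_bigr => i _; rewrite mxE exprMn.
Qed.

Lemma sqnorm_ge0 v : 0 <= sqnorm v.
Proof. by apply: sumr_ge0 => i _; exact: sqr_ge0. Qed.

Lemma sqnorm0 : sqnorm (0 : 'rV[RR]_n) = 0.
Proof. by rewrite /sqnorm big1 // => i _; rewrite mxE expr0n. Qed.

(** The squared norm is convex: in each coordinate the defect of convexity is
    [a * (1 - a) * (x - y) ^+ 2]. *)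
Lemma disk_segment u v a : 0 <= a <= 1 -> disk n u -> disk n v ->
  disk n (u + a *: (v - u)).
Proof.
move=> /andP[a0 a1]; rewrite /disk /= => du dv.
have : sqnorm (u + a *: (v - u)) <= (1 - a) * sqnorm u + a * sqnorm v.
  rewrite /sqnorm !mulr_sumr -big_split /=; apply: ler_sum => i _.
  rewrite !mxE; set x := u _ _; set y := v _ _.
  have : 0 <= (1 - a) * (a * (x - y) ^+ 2).
    by rewrite mulr_ge0 ?subr_ge0 // mulr_ge0 // sqr_ge0.
  have -> : (1 - a) * (a * (x - y) ^+ 2) =
    (1 - a) * x ^+ 2 + a * y ^+ 2 - (x + a * (y - x)) ^+ 2 by ring.
  by rewrite subr_ge0.
move/le_trans; apply.
have : (1 - a) * sqnorm u <= (1 - a) * 1 by apply: ler_wpM2l => //; lra.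
have : a * sqnorm v <= a * 1 by exact: ler_wpM2l.
lra.
Qed.

Lemma disk_compact : compact (disk n).
Proof.
apply: (@subclosed_compact _ _
  [set v : 'rV[RR]_n | forall i, `[-1, 1]%classic (v ord0 i)]).
- apply: (@preimage_closed _ _ (@sqnorm n) [set t | t <= 1]); last exact: closed_le.
  by move=> v _; apply: ctsOnT; apply: ctsOn_sqnorm; exact: ctsOn_id.
- by apply: (@rV_compact RR n (fun=> `[-1, 1]%classic)) => _; exact: segment_compact.
- move=> v; rewrite /disk /= => dv i; rewrite /= in_itv /=.
  have : v ord0 i ^+ 2 <= 1.
    apply: le_trans dv; rewrite /sqnorm (bigD1 i) //= lerDl.
    by apply: sumr_ge0 => j _; exact: sqr_ge0.
  by rewrite expr2 => v1; apply/andP; split; nra.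
Qed.

End sqnorm_theory.

Lemma hausdorff_prod {T U : topologicalType} :
  hausdorff_space T -> hausdorff_space U -> hausdorff_space (T * U)%type.
Proof.
move=> hT hU [x1 y1] [x2 y2] cl; congr pair.
  apply: hT => A B nA nB.
  have [] := cl (fst @^-1` A) (fst @^-1` B); try exact: cvg_fst.
  by move=> [z w] /= [? ?]; exists z.
apply: hU => A B nA nB.
have [] := cl (snd @^-1` A) (snd @^-1` B); try exact: cvg_snd.
by move=> [z w] /= [? ?]; exists w.
Qed.

(** * Attaching a cell *)

Section cell_attachment.
Context {Y : topologicalType} {n : nat}.
Implicit Types (u v : 'rV[RR]_n) (y : Y) (s : RR).
Variables (y0 : Y) (L' : set Y) (Phi : 'rV[RR]_n -> Y).
Hypothesis hY : hausdorff_space Y.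
Hypothesis cptL' : compact L'.
Hypothesis cPhi : ctsOn (disk n) Phi.
Hypothesis Phi_sphere : Phi @` sphere n `<=` L'.
Hypothesis Phi_odisk : forall v, odisk n v -> ~ L' (Phi v).
Hypothesis Phi_inj : forall u v, odisk n u -> odisk n v -> Phi u = Phi v -> u = v.

Let L := L' `|` Phi @` disk n.

(** The inverse of the characteristic map on the open cell. The default [0] does not matter: [crd]
    is used only at points of the open cell or multiplied by a vanishing [depth]. *)
Let crd (y : Y) : 'rV[RR]_n := xget 0 [set v | odisk n v /\ Phi v = y].
(** A continuous height on [L], equal to [1] at the centre of the cell and [0] exactly on [L']. *)
Let depth (y : Y) : RR :=
  if `[< exists2 v, odisk n v & Phi v = y >] then 1 - sqnorm (crd y) else 0.

Let crd_Phi v : odisk n v -> crd (Phi v) = v.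
Proof.
by move=> dv; apply: xget_subset1 => // u w [du Pu] [dw Pw]; apply: Phi_inj; rewrite ?Pu.
Qed.

Let disk_cases v : disk n v -> odisk n v \/ sphere n v.
Proof.
rewrite /disk /odisk /sphere /= le_eqVlt => /orP[/eqP|]; [by right|by left].
Qed.

Let depth_L' y : L' y -> depth y = 0.
Proof.
move=> Ly; rewrite /depth; case: ifPn => // /asboolP [v dv vy].
by have := Phi_odisk dv; rewrite vy.
Qed.

Let depth_Phi v : disk n v -> depth (Phi v) = 1 - sqnorm v.
Proof.
move=> /disk_cases[dv|sv].
  by rewrite /depth; case: ifPn => [_|/asboolP[]]; [rewrite crd_Phi|exists v].
by rewrite depth_L' ?sv ?subrr //; apply: Phi_sphere; exists v.
Qed.

Let depth_gt0 y : 0 < depth y -> odisk n (crd y) /\ Phi (crd y) = y.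
Proof.
rewrite /depth; case: ifPn => [/asboolP[v dv <-] _|]; last by rewrite ltxx.
by rewrite crd_Phi.
Qed.

Let depth_itv y : L y -> 0 <= depth y <= 1.
Proof.
move=> [/depth_L' ->|[v dv <-]]; first by rewrite lexx ler01.
rewrite depth_Phi //; apply/andP; split; first by rewrite subr_ge0.
by rewrite lerBlDr lerDl sqnorm_ge0.
Qed.

Let odisk_disk v : odisk n v -> disk n v.
Proof. exact: ltW. Qed.

(** [L] has the quotient topology of the disjoint union of [L'] and the disk, as these are compact
    and [Y] is Hausdorff. *)
Let ctsOn_L {Q : topologicalType} (f : Y -> Q) :
  ctsOn L' f -> ctsOn (disk n) (fun v => f (Phi v)) -> ctsOn L f.
Proof.
move=> fL fPhi; apply: ctsOn_setU => //; first exact: compact_closed.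
- apply: compact_closed => //; apply: ctsOn_compact => //; exact: disk_compact.
- by apply: ctsOn_quotient => //; exact: disk_compact.
Qed.

Let ctsOn_depth : ctsOn L depth.
Proof.
apply: ctsOn_L.
  by apply: eq_ctsOn (@ctsOn_cst _ _ L' (0 : RR)) => y; rewrite inE => /depth_L'.
apply: (@eq_ctsOn _ _ _ (fun v => 1 - sqnorm v)).
  by move=> v; rewrite inE => /depth_Phi.
by apply: ctsOn_cstB; apply: ctsOn_sqnorm; exact: ctsOn_id.
Qed.

(** Multiplied by [depth], the coordinate extends continuously by [0] over [L']; one then divides
    where [depth] is positive. *)
Let ctsOn_crd : ctsOn (L `&` [set y | 0 < depth y]) crd.
Proof.
have ck : ctsOn L (fun y => depth y *: crd y).
  apply: ctsOn_L.
    apply: eq_ctsOn (@ctsOn_cst _ _ L' (0 : 'rV[RR]_n)) => y; rewrite inE => /depth_L' ->.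
    by rewrite scale0r.
  apply: (@eq_ctsOn _ _ _ (fun v => (1 - sqnorm v) *: v)).
    move=> v; rewrite inE => dv; rewrite depth_Phi //.
    have [/crd_Phi ->//|sv] := disk_cases dv.
    by rewrite sv subrr !scale0r.
  apply: ctsOn_mxZ; last exact: ctsOn_id.
  by apply: ctsOn_cstB; apply: ctsOn_sqnorm; exact: ctsOn_id.
apply: (@eq_ctsOn _ _ _ (fun y => (depth y)^-1 *: (depth y *: crd y))).
  move=> y; rewrite inE => -[_ /= dy].
  by rewrite scalerA mulVf ?scale1r // gt_eqF.
apply: ctsOn_mxZ; last by apply: ctsOnW ck; exact: subIsetl.
apply: ctsOnV; first by move=> y [_ /= dy]; rewrite gt_eqF.
by apply: ctsOnW ctsOn_depth; exact: subIsetl.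
Qed.

(** Scaling by [(1 - s / 2)^-1], except that points which would leave the disk stop on the sphere.
    At [s = 1] all points of norm at least [1/2] have reached it. *)
Let push v (s : RR) : 'rV[RR]_n :=
  (Num.max (Num.sqrt (sqnorm v)) (1 - s / 2))^-1 *: v.
(* Expands the cell radially, until its outer half is pushed into [L']. *)
Let D (q : Y * RR) : Y :=
  if `[< exists2 v, odisk n v & Phi v = q.1 >] then Phi (push (crd q.1) q.2)
  else q.1.

Let push_den v s : unit_interval s ->
  0 < Num.max (Num.sqrt (sqnorm v)) (1 - s / 2).
Proof. by move=> /andP[s0 s1]; rewrite lt_max; apply/orP; right; lra. Qed.

Let push_sphere v s : unit_interval s -> sphere n v -> push v s = v.
Proof.
move=> /andP[s0 s1]; rewrite /sphere /= /push => ->.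
by rewrite sqrtr1 max_l ?invr1 ?scale1r //; lra.
Qed.

Let push_disk v s : unit_interval s -> disk n (push v s).
Proof.
move=> Is; rewrite /disk /= /push sqnormZ exprVn mulrC ler_pdivrMr; last first.
  by rewrite exprn_gt0 // push_den.
rewrite mul1r -{1}(sqr_sqrtr (sqnorm_ge0 v)) ler_sqr ?nnegrE ?sqrtr_ge0 //.
  by rewrite le_max lexx.
by rewrite ltW // push_den.
Qed.

Let push0 v : disk n v -> push v 0 = v.
Proof.
move=> dv; rewrite /push mul0r subr0 max_r ?invr1 ?scale1r //.
by rewrite -sqrtr1 ler_wsqrtr.
Qed.

Let push1_sphere v : 4^-1 <= sqnorm v -> sphere n (push v 1).
Proof.
move=> v4; rewrite /sphere /= /push sqnormZ max_l; last first.
  have -> : 1 - 1 / 2 = Num.sqrt (4^-1) :> RR.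
    have -> : 4^-1 = (2^-1) ^+ 2 :> RR by lra.
    by rewrite sqrtr_sqr ger0_norm //; lra.
  exact: ler_wsqrtr.
rewrite exprVn sqr_sqrtr ?sqnorm_ge0 // mulVf // gt_eqF //.
by apply: lt_le_trans v4; lra.
Qed.

Let D_L' y s : L' y -> D (y, s) = y.
Proof.
move=> Ly; rewrite /D /=; case: ifPn => // /asboolP [v dv vy].
by have := Phi_odisk dv; rewrite vy.
Qed.

Let D_Phi v s : unit_interval s -> disk n v -> D (Phi v, s) = Phi (push v s).
Proof.
move=> Is /disk_cases[dv|sv].
  by rewrite /D /=; case: ifPn => [_|/asboolP[]]; [rewrite crd_Phi|exists v].
by rewrite push_sphere // D_L' //; apply: Phi_sphere; exists v.
Qed.

Let ctsOn_D : ctsOn (L `*` unit_interval) D.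
Proof.
have -> : L `*` unit_interval = (L' `*` unit_interval) `|`
    ((fun q : 'rV[RR]_n * RR => (Phi q.1, q.2)) @` (disk n `*` unit_interval)).
  apply/seteqP; split=> [[y s] [/= [Ly|[v dv <-]] Is]|].
  - by left.
  - by right; exists (v, s).
  - by move=> ? [[? ?]|[[v s] [/= dv Is] <-]]; split => //; [left|right; exists v].
have cI : compact unit_interval.
  rewrite (_ : unit_interval = `[0, 1]%classic); first exact: segment_compact.
  by apply/seteqP; split => t; rewrite /= in_itv.
have hYR : hausdorff_space (Y * RR)%type.
  by apply: hausdorff_prod => //; exact: Rhausdorff.
have cP : ctsOn (disk n `*` unit_interval) (fun q : 'rV[RR]_n * RR => (Phi q.1, q.2)).
  apply: ctsOn_pair; last by apply: ctsOn_snd; exact: ctsOn_id.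
  apply: (ctsOn_comp _ (disk n) _ Phi) => //; last by move=> x [].
  by apply: ctsOn_fst; exact: ctsOn_id.
have cDI : compact (disk n `*` unit_interval).
  by apply: compact_setX => //; exact: disk_compact.
apply: ctsOn_setU.
- by apply: compact_closed => //; exact: compact_setX.
- by apply: compact_closed => //; exact: ctsOn_compact.
- apply: (@eq_ctsOn _ _ _ fst); first by move=> [y s]; rewrite inE => -[/= ? ?]; rewrite D_L'.
  by apply: ctsOn_fst; exact: ctsOn_id.
- apply: ctsOn_quotient => //.
  apply: (@eq_ctsOn _ _ _ (fun q => Phi (push q.1 q.2))).
    by move=> [v s]; rewrite inE => -[/= ? ?]; rewrite D_Phi.
  apply: (ctsOn_comp _ (disk n) (fun q : 'rV[RR]_n * RR => push q.1 q.2) Phi) => //.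
    apply: ctsOn_mxZ; last by apply: ctsOn_fst; exact: ctsOn_id.
    apply: ctsOnV; first by move=> q [_ /(push_den q.1) ?]; rewrite gt_eqF.
    apply: ctsOn_max.
      by apply: ctsOn_sqrt; apply: ctsOn_sqnorm; apply: ctsOn_fst; exact: ctsOn_id.
    apply: ctsOn_cstB; apply: ctsOnM; last exact: ctsOn_cst.
    by apply: ctsOn_snd; exact: ctsOn_id.
  by move=> q [_ Is]; exact: push_disk.
Qed.

Let D0 y : L y -> D (y, 0) = y.
Proof.
move=> [/D_L'//|[v dv <-]]; rewrite D_Phi ?push0 //.
by rewrite /unit_interval /= lexx ler01.
Qed.

(** In the cell, a depth of at most [3/4] is a norm of at least [1/2], and such points are pushed to
    the sphere at time [1]. *)
Let L'_D1 y : L y -> depth y <= 3 / 4 -> L' (D (y, 1)).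
Proof.
move=> [Ly|[v dv <-]]; first by rewrite D_L'.
rewrite depth_Phi // D_Phi // => [dep|]; last by rewrite /unit_interval /= lexx ler01.
by apply: Phi_sphere; exists (push v 1) => //; apply: push1_sphere; lra.
Qed.

Let ctsOn_depth_comp {T : topologicalType} (A : set T) (f : T -> Y) :
  ctsOn A f -> (forall x, A x -> L (f x)) -> ctsOn A (fun x => depth (f x)).
Proof. by move=> cf fL; apply: (ctsOn_comp _ L f depth). Qed.

Let ctsOn_crd_comp {T : topologicalType} (A : set T) (f : T -> Y) :
  ctsOn A f -> (forall x, A x -> L (f x) /\ 0 < depth (f x)) ->
  ctsOn A (fun x => crd (f x)).
Proof. by move=> cf fL; apply: (ctsOn_comp _ _ f crd _ ctsOn_crd). Qed.

Let ctsOn_D_comp {T : topologicalType} (A : set T) (f : T -> Y) (g : T -> RR) :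
  ctsOn A f -> ctsOn A g ->
  (forall x, A x -> L (f x)) -> (forall x, A x -> unit_interval (g x)) ->
  ctsOn A (fun x => D (f x, g x)).
Proof.
move=> cf cg fL gI.
apply: (ctsOn_comp _ (L `*` unit_interval) (fun x => (f x, g x)) D) => //.
  exact: ctsOn_pair.
by move=> x Ax; split; [exact: fL|exact: gI].
Qed.

(** It is [0] when [depth p.1 <= 1/8] or [depth p.2 <= 1/4], which makes the branches of [F1] fit
    together, and [1] when [depth p.1 >= 1/4] and [depth p.2 >= 1/2]. *)
Let sg (p : Y * Y) := clamp (8 * depth p.1 - 1) * clamp (4 * depth p.2 - 1).
(* Moves [p.1] along a segment of the cell towards [p.2], and onto [p.2] when
   both points are deep enough. *)
Let F1 (q : (Y * Y) * RR) : Y :=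
  if depth q.1.1 <= 8^-1 then q.1.1 else
  if depth q.1.2 <= 4^-1 then q.1.1 else
  Phi (crd q.1.1 + (q.2 * sg q.1) *: (crd q.1.2 - crd q.1.1)).
Let G (p : Y * Y) : Y := F1 (p, 1).

Let unit0 : unit_interval 0.
Proof. by rewrite /unit_interval /= lexx ler01. Qed.

Let unit1 : unit_interval 1.
Proof. by rewrite /unit_interval /= lexx ler01. Qed.

Let unitM (s t : RR) : unit_interval s -> unit_interval t -> unit_interval (s * t).
Proof.
by move=> /andP[s0 s1] /andP[t0 t1]; rewrite /unit_interval /= mulr_ge0 // mulr_ile1.
Qed.

Let unit_clamp t : unit_interval (clamp t).
Proof. exact: clamp_itv. Qed.

Let sg_itv p : unit_interval (sg p).
Proof. by apply: unitM; exact: unit_clamp. Qed.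

Let F1_segment p s : unit_interval s -> 0 < depth p.1 -> 0 < depth p.2 ->
  disk n (crd p.1 + (s * sg p) *: (crd p.2 - crd p.1)).
Proof.
move=> Is /depth_gt0[d1 _] /depth_gt0[d2 _]; apply: disk_segment.
- by apply: unitM => //; exact: sg_itv.
- exact: odisk_disk.
- exact: odisk_disk.
Qed.

Let ctsOn_F1 : ctsOn ((L `*` L) `*` unit_interval) F1.
Proof.
have c11 A : ctsOn A (fun q : (Y * Y) * RR => q.1.1).
  by apply: ctsOn_fst; apply: ctsOn_fst; exact: ctsOn_id.
have c12 A : ctsOn A (fun q : (Y * Y) * RR => q.1.2).
  by apply: ctsOn_snd; apply: ctsOn_fst; exact: ctsOn_id.
have c2 A : ctsOn A (fun q : (Y * Y) * RR => q.2).
  by apply: ctsOn_snd; exact: ctsOn_id.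
apply: ctsOn_if => //.
- by apply: ctsOn_depth_comp => // q [[]].
- exact: ctsOn_cst.
- apply: ctsOn_if => //.
  + by apply: ctsOn_depth_comp => // q [[[]]].
  + exact: ctsOn_cst.
  + apply: (ctsOn_comp _ (disk n) (fun q : (Y * Y) * RR =>
      crd q.1.1 + (q.2 * sg q.1) *: (crd q.1.2 - crd q.1.1)) Phi) => //.
      have cc1 : ctsOn ((((L `*` L) `*` unit_interval) `&`
          [set x | 8^-1 <= depth x.1.1]) `&` [set x | 4^-1 <= depth x.1.2])
          (fun q : (Y * Y) * RR => crd q.1.1).
        apply: ctsOn_crd_comp => // q [[[[L1 L2] Is] /= d1] /= d2].
        by split => //; lra.
      apply: ctsOn_mxD => //; apply: ctsOn_mxZ.
        apply: ctsOnM => //; apply: ctsOnM; apply: ctsOn_clamp; apply: ctsOn_Bcst;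
          apply: ctsOn_cstM; apply: ctsOn_depth_comp => //.
          by move=> q [[[[]]]].
        by move=> q [[[[]]]].
      apply: ctsOn_mxB => //.
      apply: ctsOn_crd_comp => // q [[[[L1 L2] Is] /= d1] /= d2].
      by split => //; lra.
    move=> [p s] [[[[L1 L2] Is] /= d1] /= d2].
    by apply: F1_segment => //; lra.
  + move=> [p s] [[[L1 L2] Is] /= d1] /= d2.
    rewrite /sg d2 (@clamp_eq0 (4 * 4^-1 - 1)); last by lra.
    rewrite !mulr0 scale0r addr0.
    by have [] : odisk n (crd p.1) /\ Phi (crd p.1) = p.1 by apply: depth_gt0; lra.
- move=> [p s] [[L1 L2] Is] /= d1; case: ifPn => // d2.
  rewrite /sg d1 (@clamp_eq0 (8 * 8^-1 - 1)); last by lra.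
  rewrite mul0r mulr0 scale0r addr0.
  by have [] : odisk n (crd p.1) /\ Phi (crd p.1) = p.1 by apply: depth_gt0; lra.
Qed.

Let L_F1 p s : L p.1 -> L p.2 -> unit_interval s -> L (F1 (p, s)).
Proof.
move=> L1 L2 Is; rewrite /F1 /=; case: ifPn => //; rewrite -ltNge => d1.
case: ifPn => //; rewrite -ltNge => d2.
right; exists (crd p.1 + (s * sg p) *: (crd p.2 - crd p.1)) => //.
by apply: F1_segment => //; lra.
Qed.

Let F1_0 p : F1 (p, 0) = p.1.
Proof.
rewrite /F1 /=; case: ifPn => //; rewrite -ltNge => d1; case: ifPn => // _.
rewrite mul0r scale0r addr0.
by have [] : odisk n (crd p.1) /\ Phi (crd p.1) = p.1 by apply: depth_gt0; lra.
Qed.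

Let F1_diag y s : F1 ((y, y), s) = y.
Proof.
rewrite /F1 /=; case: ifPn => //; rewrite -ltNge => d1; case: ifPn => // _.
rewrite subrr scaler0 addr0.
by have [] : odisk n (crd y) /\ Phi (crd y) = y by apply: depth_gt0; lra.
Qed.

Let G_deep p : 4^-1 <= depth p.1 -> 2^-1 <= depth p.2 -> G p = p.2.
Proof.
move=> d1 d2; rewrite /G /F1 /= ifF; last by apply/negbTE; rewrite -ltNge; lra.
rewrite ifF; last by apply/negbTE; rewrite -ltNge; lra.
rewrite /sg (@clamp_eq1 (8 * _ - 1)); last by lra.
rewrite (@clamp_eq1 (4 * _ - 1)); last by lra.
rewrite !mulr1 scale1r addrC subrK.
by have [] : odisk n (crd p.2) /\ Phi (crd p.2) = p.2 by apply: depth_gt0; lra.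
Qed.

Let ctsOn_G : ctsOn (L `*` L) G.
Proof.
apply: (ctsOn_comp _ _ (fun p : Y * Y => (p, 1 : RR)) F1 _ ctsOn_F1) => //.
by apply: ctsOn_pair; [exact: ctsOn_id|exact: ctsOn_cst].
Qed.

Let L_G p : (L `*` L) p -> L (G p).
Proof. by move=> [L1 L2]; exact: L_F1. Qed.

(** A vertex in the open cell is the centre of a cell of dimension [0]. There [w2] vanishes, so the
    radial motions fix the base point. *)
Hypothesis y0_vertex : L y0 -> L' y0 \/ Phi 0 = y0.

(** [w1] drops from [1] to [0] as [depth p.2] goes from [1/2] to [5/8], and [w2] does so from [5/8]
    to [3/4]: as long as [w1] is positive, the radial motions are complete. *)
Let w1 (p : Y * Y) := clamp (8 * (5 / 8 - depth p.2)).
Let w2 (p : Y * Y) := clamp (8 * (3 / 4 - depth p.2)).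

(* Five consecutive motions [h1], ..., [h5] take [p.1] to [p.2].  The fourth one
   runs the homotopy of [L'] backwards from [p.2] to itself: so, when [p.1] has
   already reached [p.2], the third and fourth motions cancel, and [w1] can
   switch them off as [p.2] moves towards the centre of the cell; afterwards [w2]
   does the same with the radial motions [h2] and [h5]. *)
Lemma proj_homotopic_cell : proj_homotopic y0 L' -> proj_homotopic y0 L.
Proof.
move=> [eps' [ceps' eps'0 [lam' [clam' lam'0 lam'1 lam'B]]]].
(* The factor [16] turns [eps p < 1] into differences of depths below [1/16], less than the gaps
   between the thresholds. *)
pose e1 (p : Y * Y) : RR := 16 * `|depth p.1 - depth p.2|.
pose e2 (p : Y * Y) : RR := 16 * `|depth (G p) - depth p.2|.
(* Controls whether the pushed points lie in the domain of [lam']. The cutoffs vanish where a push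
   may miss [L'], and are [1] up to depth [11/16 = 5/8 + 1/16], hence wherever [lam'] is used. *)
pose e3 (p : Y * Y) : RR := if 3 / 4 <= depth p.2 then 0 else
  if 3 / 4 <= depth (G p) then 0 else
  clamp (16 * (3 / 4 - depth p.2)) * clamp (16 * (3 / 4 - depth (G p))) *
  eps' (D (G p, 1), D (p.2, 1)).
pose eps (p : Y * Y) : RR := Num.max (Num.max (e1 p) (e2 p)) (e3 p).
have c1 A : ctsOn A (fun p : Y * Y => p.1) by apply: ctsOn_fst; exact: ctsOn_id.
have c2 A : ctsOn A (fun p : Y * Y => p.2) by apply: ctsOn_snd; exact: ctsOn_id.
have cd2 : ctsOn (L `*` L) (fun p => depth p.2).
  by apply: ctsOn_depth_comp => // p [].
have cdG : ctsOn (L `*` L) (fun p => depth (G p)).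
  by apply: ctsOn_depth_comp => //; exact: L_G.
exists eps; split.
- apply: ctsOn_max; first apply: ctsOn_max.
  + apply: ctsOn_cstM; apply: ctsOn_norm; apply: ctsOnB => //.
    by apply: ctsOn_depth_comp => // p [].
  + by apply: ctsOn_cstM; apply: ctsOn_norm; exact: ctsOnB.
  + apply: ctsOn_if => //; [exact: ctsOn_cst|exact: ctsOn_cst| |].
    * apply: ctsOn_if => //; [exact: ctsOn_cst| | exact: ctsOn_cst | |].
      - by apply: ctsOnW cdG; exact: subIsetl.
      - apply: ctsOnM.
          apply: ctsOnM; apply: ctsOn_clamp; apply: ctsOn_cstM; apply: ctsOn_cstB.
            by apply: ctsOnW cd2 => p [[]].
          by apply: ctsOnW cdG => p [[]].
        apply: (ctsOn_comp _ _ (fun p : Y * Y => (D (G p, 1), D (p.2, 1))) eps' _ ceps').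
          apply: ctsOn_pair; apply: ctsOn_D_comp => //; try exact: ctsOn_cst.
          - by apply: ctsOnW ctsOn_G => p [[]].
          - by move=> p [[/L_G]].
          - by move=> p [[[]]].
        move=> p [[LLp /= d2] /= dG]; split; apply: L'_D1 => //; first exact: L_G.
        by case: LLp.
      - move=> p [LLp /= d2] dG; rewrite -dG subrr mulr0 (@clamp_eq0 0) //.
        by rewrite mulr0 mul0r.
    * move=> p LLp /= d2; case: ifPn => // dG.
      by rewrite -d2 subrr mulr0 (@clamp_eq0 0) // !mul0r.
- move=> y Ly; have Gy : G (y, y) = y by exact: F1_diag.
  rewrite /eps /e1 /e2 Gy /= subrr normr0 mulr0 maxxx (_ : e3 (y, y) = 0) ?maxxx //.
  rewrite /e3 Gy /=; case: ifPn => //; rewrite -ltNge => d2.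
  rewrite ifF; last by apply/negbTE; rewrite -ltNge.
  by rewrite eps'0 ?mulr0 //; apply: L'_D1 => //; exact: ltW.
set N := (_ `&` _).
set B := [set p | _].
have NLL p : N p -> (L `*` L) p by case.
have Nd p : N p -> `|depth p.1 - depth p.2| < 16^-1 /\ `|depth (G p) - depth p.2| < 16^-1.
  by move=> [_ /=]; rewrite /eps !gt_max /e1 /e2 => /andP[/andP[]]; lra.
(* Here [depth p.1] exceeds [7/16], so the segment motion has taken [p.1] onto [p.2]. *)
have Ndeep p : N p -> 2^-1 <= depth p.2 -> G p = p.2.
  move=> /Nd[+ _] d2; rewrite ltr_norml => /andP[d1 _]; apply: G_deep => //; lra.
have Nshallow p : N p -> depth p.2 <= 5 / 8 ->
    ((L' `*` L') `&` [set p | eps' p < 1]) (D (G p, 1), D (p.2, 1)).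
  move=> Np d2; have [_] := Nd p Np; rewrite ltr_norml => /andP[_ dG].
  have LLp := NLL _ Np.
  split.
    split; apply: L'_D1 => /=; [exact: L_G|by lra|by case: LLp|by lra].
  case: Np => _ /=; rewrite /eps !gt_max => /andP[_].
  rewrite /e3 ifF; last by apply/negbTE; rewrite -ltNge; lra.
  rewrite ifF; last by apply/negbTE; rewrite -ltNge; lra.
  by rewrite clamp_eq1 ?clamp_eq1 ?mul1r //; lra.
have Nshallow2 p : N p -> depth p.2 <= 5 / 8 ->
    ((L' `*` L') `&` [set p | eps' p < 1]) (D (p.2, 1), D (p.2, 1)).
  move=> Np d2; have L'2 : L' (D (p.2, 1)).
    by apply: L'_D1; [case: (NLL _ Np)|lra].
  by split => //=; rewrite eps'0.
have cq1 A : ctsOn A (fun q : (Y * Y) * RR => q.1) by apply: ctsOn_fst; exact: ctsOn_id.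
have cq12 A : ctsOn A (fun q : (Y * Y) * RR => q.1.2) by apply: ctsOn_snd.
have cq2 A : ctsOn A (fun q : (Y * Y) * RR => q.2) by apply: ctsOn_snd; exact: ctsOn_id.
have cqG : ctsOn (N `*` unit_interval) (fun q => G q.1).
  by apply: (ctsOn_comp _ _ (fun q : (Y * Y) * RR => q.1) G _ ctsOn_G) => // q [/NLL].
have cqd : ctsOn (N `*` unit_interval) (fun q => depth q.1.2).
  by apply: ctsOn_depth_comp => // q [/NLL []].
have cw1 : ctsOn (N `*` unit_interval) (fun q => w1 q.1).
  by apply: ctsOn_clamp; apply: ctsOn_cstM; exact: ctsOn_cstB.
have cw2 : ctsOn (N `*` unit_interval) (fun q => w2 q.1).
  by apply: ctsOn_clamp; apply: ctsOn_cstM; exact: ctsOn_cstB.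
have w2I p : unit_interval (w2 p) by exact: unit_clamp.
have w1I p : unit_interval (w1 p) by exact: unit_clamp.
have w2_1 p : depth p.2 <= 5 / 8 -> w2 p = 1 by move=> d2; apply: clamp_eq1; lra.
have w1_1 p : depth p.2 <= 2^-1 -> w1 p = 1 by move=> d2; apply: clamp_eq1; lra.
have onem (s : RR) : unit_interval s -> unit_interval (1 - s).
  by move=> /andP[s0 s1]; apply/andP; split; lra.
have GB p : B p -> G p = y0 by move=> [_ ->]; exact: F1_diag.
have y0_cases p : B p -> (L' y0 /\ depth p.2 = 0) \/ (w2 p = 0 /\ depth p.2 = 1).
  move=> [Ly0 ->] /=; have [L'y0|P0] := y0_vertex Ly0.
    by left; rewrite depth_L'.
  right; have d1 : depth y0 = 1.
    by rewrite -P0 depth_Phi ?sqnorm0 ?subr0 // /disk /= sqnorm0 ler01.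
  by split=> //; rewrite /w2 /= d1; apply: clamp_eq0; lra.
have DB p s : B p -> D (y0, s * w2 p) = y0.
  move=> Bp; have [[Ly0 _]|[-> _]] := y0_cases p Bp; first by rewrite D_L'.
  by rewrite mulr0 D0 //; case: Bp.
have h1 : homot y0 N B fst G.
  exists F1; split.
  - by apply: ctsOnW ctsOn_F1 => q [/NLL].
  - by move=> p _; exact: F1_0.
  - by [].
  - by move=> p t [_ ->] _; exact: F1_diag.
have h2 : homot y0 N B G (fun p => D (G p, w2 p)).
  exists (fun q => D (G q.1, q.2 * w2 q.1)); split.
  - apply: ctsOn_D_comp => //; first exact: ctsOnM.
      by move=> q [/NLL/L_G].
    by move=> q [_ ?]; exact: unitM.
  - by move=> p Np; rewrite mul0r D0 //; apply/L_G/NLL.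
  - by move=> p Np; rewrite mul1r.
  - by move=> p t Bp _; rewrite GB // DB.
(* Where [depth p.2 = 5/8], [w1] is [0] and [w2] is [1], so the two branches agree. *)
pose M p := if 5 / 8 <= depth p.2 then D (G p, w2 p)
  else lam' ((D (G p, 1), D (p.2, 1)), w1 p).
have h3 : homot y0 N B (fun p => D (G p, w2 p)) M.
  exists (fun q => if 5 / 8 <= depth q.1.2 then D (G q.1, w2 q.1)
    else lam' ((D (G q.1, 1), D (q.1.2, 1)), q.2 * w1 q.1)); split.
  - apply: ctsOn_if => //; first exact: ctsOn_cst.
    + apply: ctsOnW; first exact: subIsetl.
      by apply: ctsOn_D_comp => // q [/NLL/L_G].
    + apply: (ctsOn_comp _ _ (fun q : (Y * Y) * RR =>
        ((D (G q.1, 1), D (q.1.2, 1)), q.2 * w1 q.1)) lam' _ clam').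
        apply: (@ctsOnW _ _ _ (N `*` unit_interval)); first exact: subIsetl.
        apply: ctsOn_pair; last exact: ctsOnM.
        apply: ctsOn_pair; apply: ctsOn_D_comp => //; try exact: ctsOn_cst.
          by move=> q [/NLL/L_G].
        by move=> q [/NLL[]].
      move=> [p s] [[/= Np Is] d2]; split; first exact: Nshallow.
      exact: unitM.
    + move=> [p s] [/= Np Is] d2; rewrite w2_1 ?d2 // /w1 -d2 subrr mulr0.
      rewrite (@clamp_eq0 0) // mulr0 lam'0 //.
      by apply: Nshallow => //; rewrite d2.
  - move=> p Np /=; case: ifPn => //; rewrite -ltNge => d2.
    by rewrite mul0r lam'0 ?w2_1 //=; [exact: ltW|apply: Nshallow => //; exact: ltW].
  - by move=> p Np /=; rewrite /M mul1r.
  - move=> p t Bp It /=; rewrite GB //; have p2 : p.2 = y0 by [case: Bp => _ ->]; rewrite p2.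
    case: ifPn => d2; first by rewrite -[w2 p]mul1r DB.
    have [[Ly0 _]|[_ d20]] := y0_cases p Bp.
      by rewrite !D_L' // lam'B //; exact: unitM.
    by exfalso; move: d2; rewrite -ltNge -p2; lra.
have h4 : homot y0 N B M (fun p => D (p.2, w2 p)).
  exists (fun q => if 5 / 8 <= depth q.1.2 then D (q.1.2, w2 q.1)
    else lam' ((D (q.1.2, 1), D (q.1.2, 1)), (1 - q.2) * w1 q.1)); split.
  - apply: ctsOn_if => //; first exact: ctsOn_cst.
    + apply: ctsOnW; first exact: subIsetl.
      by apply: ctsOn_D_comp => // q [/NLL[]].
    + apply: (ctsOn_comp _ _ (fun q : (Y * Y) * RR =>
        ((D (q.1.2, 1), D (q.1.2, 1)), (1 - q.2) * w1 q.1)) lam' _ clam').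
        apply: (@ctsOnW _ _ _ (N `*` unit_interval)); first exact: subIsetl.
        apply: ctsOn_pair; last by apply: ctsOnM => //; exact: ctsOn_cstB.
        by apply: ctsOn_pair; apply: ctsOn_D_comp => //; try exact: ctsOn_cst;
          move=> q [/NLL[]].
      move=> [p s] [[/= Np Is] d2]; split; first exact: Nshallow2.
      by apply: unitM => //; exact: onem.
    + move=> [p s] [/= Np Is] d2; rewrite w2_1 ?d2 // /w1 -d2 subrr mulr0.
      rewrite (@clamp_eq0 0) // mulr0 lam'0 //.
      by apply: Nshallow2 => //; rewrite d2.
  (* The third and fourth motions meet: either [G p = p.2], or [w1 p = 1] and both runs of [lam']
     are at their end [D (p.2, 1)]. *)
  - move=> p Np /=; rewrite subr0 mul1r /M; case: ifPn => d2; first by rewrite Ndeep //; lra.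
    have [d2'|d2'] := leP 2^-1 (depth p.2); first by rewrite Ndeep.
    have d2'' : depth p.2 <= 5 / 8 by lra.
    rewrite w1_1; last exact: ltW.
    by rewrite (lam'1 _ (Nshallow _ Np d2'')) (lam'1 _ (Nshallow2 _ Np d2'')).
  - move=> p Np /=; case: ifPn => //; rewrite -ltNge => d2.
    by rewrite subrr mul0r lam'0 ?w2_1 //=; [exact: ltW|apply: Nshallow2 => //; exact: ltW].
  - move=> p t Bp It /=; have p2 : p.2 = y0 by [case: Bp => _ ->]; rewrite p2.
    case: ifPn => d2; first by rewrite -[w2 p]mul1r DB.
    have [[Ly0 _]|[_ d20]] := y0_cases p Bp.
      by rewrite !D_L' // lam'B //; apply: unitM => //; exact: onem.
    by exfalso; move: d2; rewrite -ltNge -p2; lra.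
have h5 : homot y0 N B (fun p => D (p.2, w2 p)) snd.
  exists (fun q => D (q.1.2, (1 - q.2) * w2 q.1)); split.
  - apply: ctsOn_D_comp => //.
    + by apply: ctsOnM => //; exact: ctsOn_cstB.
    + by move=> q [/NLL[]].
    + by move=> q [_ ?]; apply: unitM => //; exact: onem.
  - by move=> p Np; rewrite subr0 mul1r.
  - by move=> p Np; rewrite subrr mul0r D0 //; case: (NLL _ Np).
  - by move=> p t Bp _ /=; have -> : p.2 = y0 by [case: Bp => _ ->]; rewrite DB.
apply: homot_trans h1 _; apply: homot_trans h2 _; apply: homot_trans h3 _.
exact: homot_trans h4 h5.
Qed.

End cell_attachment.

Lemma ctsOn_preimage_closed {T U : topologicalType} (A : set T) (D : set U)
    (f : T -> U) : closed A -> closed D -> ctsOn A f -> closed (A `&` f @^-1` D).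
Proof.
move=> cA cD cf; rewrite -openC openE => x /=.
have [Ax|NAx] := pselect (A x).
  move=> ND; have NDx : ~ D (f x) by move=> Dx; exact: ND.
  apply: filterS (nbhs_within_closedN cf cD Ax NDx) => y /= h [Ay]; exact: h.
move=> _; have : nbhs x (~` A) by apply: open_nbhs_nbhs; split => //; exact: closed_openC.
by apply: filterS => y /= NA [].
Qed.

(** * Finite subcomplexes *)

Section finite_subcomplexes.
Context {Y : topologicalType} (y0 : Y).
Hypothesis hY : hausdorff_space Y.
Context {I : Type} {dim : I -> nat} {Phi : forall i, 'rV[RR]_(dim i) -> Y}.
Hypothesis cPhi : forall i, ctsOn (disk (dim i)) (@Phi i).
Hypothesis cells : forall x, exists! i, exists2 v, odisk (dim i) v & Phi v = x.
Hypothesis Phi_inj : forall i (u v : 'rV[RR]_(dim i)),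
  odisk _ u -> odisk _ v -> Phi u = Phi v -> u = v.
Hypothesis closure_finite : forall i, exists J : set I, [/\ finite_set J,
  forall j, J j -> (dim j < dim i)%N &
  @Phi i @` sphere (dim i) `<=` \bigcup_(j in J) (@Phi j @` odisk (dim j))].
Hypothesis weak_topology : forall A : set Y, closed A <->
  forall i, closed (disk (dim i) `&` @Phi i @^-1` A).
Hypothesis y0_vertex : exists i (v : 'rV[RR]_(dim i)), dim i = 0%N /\ Phi v = y0.

Let cell_unique i j u v : odisk (dim i) u -> odisk (dim j) v ->
  Phi u = Phi v -> i = j.
Proof.
move=> du dv uv; have [k [_ ku]] := cells (Phi u).
by rewrite -(ku i) ?(ku j) //; [exists v|exists u].
Qed.

(* The last clause says that [L] is a union of closed cells. *)
Let subcomplex (L : set Y) :=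
  [/\ compact L, proj_homotopic y0 L &
      forall i, (forall v, odisk (dim i) v -> ~ L (Phi v)) \/
                @Phi i @` disk (dim i) `<=` L].

Let subcomplex0 : subcomplex set0.
Proof.
split; first exact: compact0.
  exists (fun=> 0); split => //; first by move=> ? [].
  by exists (fun=> y0); split => //; [move=> ? [[[]]]|move=> ? [[]]|move=> ? [[]]].
by move=> i; left=> ? _ [].
Qed.

Let add_attached L i : subcomplex L -> @Phi i @` sphere (dim i) `<=` L ->
  exists M, [/\ subcomplex M, L `<=` M & @Phi i @` disk (dim i) `<=` M].
Proof.
move=> [cL hL uL] sL; have [NL|PL] := uL i; last by exists L; split=> //; split.
exists (L `|` @Phi i @` disk (dim i)); split; [|exact: subsetUl|exact: subsetUr].
split.
- by apply: compactU => //; apply: ctsOn_compact => //; exact: disk_compact.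
- apply: proj_homotopic_cell => //; first exact: Phi_inj.
  move=> [|[v dv vy0]]; [by left|].
  have [ov|sv] : odisk (dim i) v \/ sphere (dim i) v.
    move: dv; rewrite /disk /odisk /sphere /= le_eqVlt.
    by move=> /orP[/eqP|]; [right|left].
  (* If [y0] lies in the open cell, this cell is the vertex, and a row vector of length [0] is
     [0]. *)
  + right; have [j [w [j0 wy0]]] := y0_vertex.
    have ow : odisk (dim j) w.
      by rewrite /odisk /= /sqnorm; move: w {wy0}; rewrite j0 => w; rewrite big_ord0 ltr01.
    have ij : i = j by apply: (cell_unique ov ow); rewrite vy0.
    have v0 : v = 0.
      by move: v {dv vy0 ov}; rewrite ij j0 => v; apply/rowP => -[].
    by rewrite -v0.
  + by left; apply: sL; exists v.
- move=> j; have [NLj|PLj] := uL j; last first.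
    by right; apply: subset_trans PLj _; exact: subsetUl.
  have [ij|ij] := pselect (i = j); first by right; rewrite -ij; exact: subsetUr.
  left=> v ov [/(NLj v ov)//|[u du uv]].
  have [ou|su] : odisk (dim i) u \/ sphere (dim i) u.
    move: du; rewrite /disk /odisk /sphere /= le_eqVlt.
    by move=> /orP[/eqP|]; [right|left].
    by apply: ij; exact: (cell_unique ou ov).
  by apply: (NLj v ov); rewrite -uv; apply: sL; exists u.
Qed.

Let add_cells (J : set I) : finite_set J ->
  (forall i, J i -> forall L, subcomplex L ->
     exists M, [/\ subcomplex M, L `<=` M & @Phi i @` disk (dim i) `<=` M]) ->
  forall L, subcomplex L -> exists M, [/\ subcomplex M, L `<=` M &
    forall i, J i -> @Phi i @` disk (dim i) `<=` M].
Proof.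
move=> /finite_setP [m]; elim: m J => [|m IHm] J.
  rewrite II0 card_eq0 => /eqP -> _ L sL; exists L; split => //.
move=> /eq_cardSP[i Ji Jm] addJ L sL.
have [M [sM LM JM]] := IHm _ Jm (fun j Jj => addJ j (Jj.1)) L sL.
have [M' [sM' MM' iM']] := addJ i Ji M sM.
exists M'; split => //; first exact: subset_trans MM'.
move=> j Jj; have [->//|ji] := pselect (j = i).
by apply: subset_trans MM'; apply: JM.
Qed.

(** Strong induction on the dimension: the boundary sphere lies in finitely many cells of smaller
    dimension, which are added first. *)
Let add_cell i L : subcomplex L ->
  exists M, [/\ subcomplex M, L `<=` M & @Phi i @` disk (dim i) `<=` M].
Proof.
have [m] := ubnP (dim i); elim: m i L => // m IHm i L; rewrite ltnS => im sL.
have [J [fJ Jlt Jsph]] := closure_finite i.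
have [M [sM LM JM]] := add_cells fJ
  (fun j Jj L sL => IHm j L (leq_trans (Jlt j Jj) im) sL) sL.
have [|M' [sM' MM' iM']] := @add_attached M i sM.
  move=> y /Jsph [j Jj [v ov <-]]; apply: (JM j Jj); exists v => //.
  exact: ltW.
by exists M'; split => //; exact: subset_trans MM'.
Qed.

(** Choose a point of [C] in every open cell that meets [C]. All subsets of the set of these points
    are closed, so this set is discrete and compact, hence finite. *)
Let meet_finite (C : set Y) : compact C ->
  finite_set [set i | exists2 v, odisk (dim i) v & C (@Phi i v)].
Proof.
move=> cC; set J := [set i | _].
have [pt ptP] : {pt : I -> Y & forall i, J i -> C (pt i) /\
    exists2 v, odisk (dim i) v & @Phi i v = pt i}.
  have /choice [pt ptP] : forall i, exists y, J i -> C y /\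
      exists2 v, odisk (dim i) v & @Phi i v = y.
    move=> i; have [[v ov Cv]|NJ] := pselect (J i); last by exists y0.
    by exists (Phi v) => _; split => //; exists v.
  by exists pt.
have pt_inj i j : J i -> J j -> pt i = pt j -> i = j.
  move=> Ji Jj ij; have [_ [u ou iu]] := ptP i Ji; have [_ [v ov jv]] := ptP j Jj.
  by apply: (cell_unique ou ov); rewrite iu jv.
have sub_closed (K : set I) : K `<=` J -> closed (pt @` K).
  move=> KJ; apply/weak_topology => i.
  have [J' [fJ' _ sph]] := closure_finite i.
  (* The closed cell [i] meets only the open cells [i] and those of [J'], so only finitely many
     chosen points count. *)
  have -> : disk (dim i) `&` @Phi i @^-1` (pt @` K) =
            disk (dim i) `&` @Phi i @^-1` (pt @` (K `&` (i |` J'))).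
    apply/seteqP; split=> v [dv [j Kj jv]]; split => //; last first.
      by exists j => //; case: Kj.
    exists j => //; split => //; have [_ [u ou ju]] := ptP j (KJ _ Kj).
    have [ov|sv] : odisk (dim i) v \/ sphere (dim i) v.
      move: dv; rewrite /disk /odisk /sphere /= le_eqVlt.
      by move=> /orP[/eqP|]; [right|left].
      by left; apply: (cell_unique ou ov); rewrite ju.
    right; have [k Jk [w ow wv]] := sph (Phi v) (imageP _ sv).
    by rewrite (_ : j = k) //; apply: (cell_unique ou ow); rewrite ju wv.
  have : closed (pt @` (K `&` (i |` J'))).
    have /accessible_finite_set_closed := hausdorff_accessible hY; apply.
    apply: finite_image; apply: finite_setIr; rewrite finite_setU; split => //.
  move=> cK; apply: ctsOn_preimage_closed => //.
  apply: compact_closed; last exact: disk_compact.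
  exact: norm_hausdorff.
have cT : compact (pt @` J).
  apply: subclosed_compact cC _; first exact: sub_closed.
  by move=> _ [i Ji <-]; case: (ptP i Ji).
suff : finite_set (pt @` J).
  by rewrite (eq_finite_set (inj_card_eq _)) // => i j; rewrite !inE; exact: pt_inj.
(* The filter of cofinite subsets: a cluster point [p] would be isolated in the set, yet the set
   without [p] belongs to the filter. *)
apply: contrapT => infT; pose F := [set A | finite_set (pt @` J `\` A)].
have FF : ProperFilter F.
  split; first by rewrite /F /= setD0.
  split; first by rewrite /F /= setDT; exact: finite_set0.
    by move=> P Q FP FQ; rewrite /F /= setDIr finite_setU.
  by move=> P Q PQ; apply: sub_finite_set; exact: setDS.
have [p [Tp /(_ (pt @` J `\` [set p]) (~` (pt @` (J `\` [set i | pt i = p]))))]] :=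
  cT F FF (eq_ind_r finite_set (finite_set0 _) (setDv _)).
case.
- rewrite /F /= setDD; apply: sub_finite_set (finite_set1 p); exact: subIsetr.
- apply: open_nbhs_nbhs; split; last by move=> [i [_ ip] ?]; exact: ip.
  by apply: closed_openC; apply: sub_closed; exact: subDsetl.
- by move=> _ [[[i Ji <-] ip] /= NP]; apply: NP; exists i.
Qed.

Lemma compact_in_proj_homotopic (C : set Y) : compact C ->
  exists L, [/\ C `<=` L, compact L & proj_homotopic y0 L].
Proof.
move=> /meet_finite fJ; have [M [[cM hM _] _ JM]] :=
  add_cells fJ (fun i _ => add_cell i) subcomplex0.
exists M; split => // y Cy; have [i [[v ov vy] _]] := cells y.
by apply: (JM i); [exists v => //; rewrite vy|exists v => //; exact: ltW].
Qed.

End finite_subcomplexes.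

Lemma based_CW_proj_homotopic (Y : topologicalType) (y0 : Y) (C : set Y) :
  is_based_CW Y y0 -> compact C ->
  exists L, [/\ C `<=` L, compact L & proj_homotopic y0 L].
Proof.
move=> [hY [I [dim [Phi [[cPhi cells inj] [_ cf wt v]]]]]] cC.
apply: (compact_in_proj_homotopic hY) wt v _ cC => // i.
exact/ctsOnP.
Qed.

(** * Formal combinations and local operators *)

(** Generators may be repeated, so that pushing forward is just composition with [g] and no terms
    have to be collected. *)
Definition lc {W : choiceType} {I : finType} (n : I -> int) (g : I -> W) : W -> int :=
  fun w => \sum_(i | g i == w) n i.

Section linear_combinations.
Context {W W' : choiceType} {I : finType}.
Implicit Types (n : I -> int) (g : I -> W).

Lemma fsupp_lc n g : fsupp (lc n g) `<=` range g.
Proof.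
move=> w; rewrite /fsupp /= => /eqP nw; apply: contrapT => Ng; apply: nw.
by rewrite /lc big_pred0 // => i; apply/negP => /eqP giw; apply: Ng; exists i.
Qed.

Lemma finite_fsupp_lc n g : finite_set (fsupp (lc n g)).
Proof.
apply: sub_finite_set (fsupp_lc (g := g)) _.
by apply: finite_image; exact: finite_finset.
Qed.

Lemma freeab_lc n g (S : set W) : (forall i, S (g i)) -> freeab S (lc n g).
Proof.
move=> gS; split; first exact: finite_fsupp_lc.
by move=> w /fsupp_lc [i _ <-].
Qed.

Lemma push_lc n g (f : W -> W') : push f (lc n g) = lc n (fun i => f (g i)).
Proof.
apply/funext => w'; rewrite /push.
have fD : finite_set (range g `&` f @^-1` [set w']).
  by apply: finite_setIl; apply: finite_image; exact: finite_finset.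
(* Cancellation may make the support smaller than [range g]; the extra terms are zero. *)
rewrite (@fsbig_widen _ _ _ _ _ (range g `&` f @^-1` [set w'])); last 2 first.
- by apply: setSI; exact: fsupp_lc.
- move=> w [[_ fw]] /= /not_andP[|//]; rewrite /fsupp /= => /negP.
  by rewrite negbK => /eqP.
rewrite fsbig_finite //= /lc (exchange_big_dep predT) //=.
rewrite [RHS]big_mkcond /=; apply: eq_bigr => i _.
rewrite -big_filter; set s := fset_set _.
have us : uniq s by exact: fset_uniq.
rewrite (eq_filter (a2 := pred1 (g i))); last by move=> w /=; rewrite eq_sym.
have [fgi|fgi] := eqVneq (f (g i)) w'.
  rewrite filter_pred1_uniq //; first by rewrite big_seq1.
  by rewrite in_fset_set // inE; split => //; exists i.
rewrite (_ : [seq _ <- _ | _] = [::]) ?big_nil //.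
apply/eqP; rewrite -[_ == _]negbK -has_filter; apply/hasPn => w.
rewrite in_fset_set // inE => -[_ /= fw]; apply/eqP => wg.
by move: fgi; rewrite -wg fw eqxx.
Qed.

End linear_combinations.

Lemma finite_fsupp_lcE {W : choiceType} (S : set W) (c : W -> int) : freeab S c ->
  exists (I : finType) (n : I -> int) (g : I -> W),
    c = lc n g /\ forall i, S (g i).
Proof.
move=> [fc cS]; pose F := fset_set (fsupp c).
exists F, (fun i : F => c (val i)), (fun i : F => val i); split; last first.
  by move=> i; apply: cS; have := valP i; rewrite in_fset_set // inE.
apply/funext => w; rewrite /lc.
have [wF|wF] := boolP (w \in F).
  by rewrite (big_pred1 [` wF]%fset) //= => i; rewrite -val_eqE.
rewrite big_pred0.
  by apply/eqP; apply: contraNT wF => cw; rewrite in_fset_set // inE.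
by move=> i; apply/negP => /eqP iw; move: wF; rewrite -iw (valP i).
Qed.

Lemma gen_sub_lc {W : choiceType} {I : finType} (n : I -> int) (g : I -> W) w0 :
  (fun w => gen w0 w - lc n g w) =
  lc (fun o : 'I_1 + I => if o is inr i then - n i else 1)
     (fun o : 'I_1 + I => if o is inr i then g i else w0).
Proof.
apply/funext => w; rewrite /lc big_sumType /=; congr (_ + _).
  rewrite big_mkcond big_ord1 /gen eq_sym.
  by case: asboolP => [->|ww0]; [rewrite eqxx|case: eqP].
by rewrite sumrN.
Qed.

(** * Layouts and fissile combinations *)

Section layouts.
Context {E : finType} {X Y : topologicalType} (y0 : Y).
Implicit Types (g : Smap E X Y) (A : {set {set E}}) (U : set {ptws E -> RR}).

(** A point common to faces with disjoint vertex sets would have all coordinates [0], against their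
    sum [1]. *)
Lemma face_inj A F G t : layout A -> F \in A -> G \in A ->
  face F t -> face G t -> F = G.
Proof.
move=> [_ disj] FA GA [[_ t1] tF] [_ tG]; apply/eqP/contraT => FG.
move: t1; rewrite big1 => [/eqP|e _]; first by rewrite eq_sym oner_eq0.
have [eF|/tF//] := boolP (e \in F); apply: tG; apply/negP => eG.
have : e \in F :&: G by rewrite finset.in_setI eF.
by rewrite disj // finset.in_set0.
Qed.

Lemma layout_space_simplex A : layout_space A `<=` simplex E.
Proof. by move=> t [F _ []]. Qed.

Context {I : finType}.
Implicit Types (n : I -> int) (w : I -> Smap E X Y) (phi : {ffun {set E} -> I}).

(** These are the maps on [Delta[A]] that occur when a combining product of combinations is
    expanded. *)
Definition glued A w phi : Smap E X Y :=
  fun t => if [pick F in A | `[< face F t >]] is Some F then w (phi F) t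
           else (fun _ => y0).

Lemma glued_face A w phi F t : layout A -> F \in A -> face F t ->
  glued A w phi t = w (phi F) t.
Proof.
move=> lA FA Ft; rewrite /glued; case: pickP => [G /andP[GA /asboolP Gt]|/(_ F)].
  by rewrite (face_inj lA FA GA Ft Gt).
by rewrite FA /=; case: asboolP.
Qed.

Lemma glued_out A w phi t : ~ layout_space A t ->
  glued A w phi t = (fun _ => y0).
Proof.
move=> At; rewrite /glued; case: pickP => // F /andP[FA /asboolP Ft].
by case: At; exists F.
Qed.

Lemma glued_eqP A w phi g : layout A ->
  (glued A w phi = g) <-> (g = restr y0 (layout_space A) g /\
   forall F, F \in A -> restr y0 (face F) (w (phi F)) = restr y0 (face F) g).
Proof.
move=> lA; split=> [<-|[gA gF]].
  split=> [|F FA]; apply/funext => t; rewrite /restr; case: asboolP => // Ft.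
    exact: glued_out.
  by rewrite (glued_face _ _ lA FA Ft).
apply/funext => t; have [[F FA Ft]|At] := pselect (layout_space A t); last first.
  by rewrite glued_out // gA /restr; case: asboolP.
rewrite (glued_face _ _ lA FA Ft).
by have /(congr1 (fun h => h t)) := gF F FA; rewrite /restr; case: asboolP.
Qed.

(** Distributivity: a term of the expanded product chooses an index for each [F] in [A]. Asking
    [phi] to be [i0] outside [A] counts every choice once. *)
Lemma comb_lc A n w (i0 : I) : layout A ->
  comb y0 A (fun F => lc n (fun i => restr y0 (face F) (w i))) =
  lc (fun phi : {ffun {set E} -> I} =>
        if phi \in pffun_on i0 (fun F => F \in A) (fun=> true) then \prod_(F in A) n (phi F) else 0)
     (glued A w).
Proof.
move=> lA; apply/funext => g; rewrite /comb; case: asboolP => [gA|gA]; last first.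
  rewrite /lc big_pred0 // => phi; apply/negP => /eqP /glued_eqP -/(_ lA) [//].
transitivity (\prod_(F in A) \sum_(i : I)
  (if restr y0 (face F) (w i) == restr y0 (face F) g then n i else 0)).
  by apply: eq_bigr => F _; rewrite /lc big_mkcond.
rewrite (big_distr_big i0) /lc [RHS]big_mkcond [LHS]big_mkcond /=.
apply: eq_bigr => phi _; case: ifPn => _; last by case: ifP.
case: eqP => [/glued_eqP -/(_ lA) [_ gF]|Ng].
  by apply: eq_bigr => F FA; rewrite gF // eqxx.
have [F /andP[FA NF]|NF] := pickP [pred F | (F \in A) &&
    (restr y0 (face F) (w (phi F)) != restr y0 (face F) g)].
  by rewrite (bigD1 F) //= (negbTE NF) mul0r.
case: Ng; apply/glued_eqP => //; split => // F FA.
by have /= := NF F; rewrite FA /= => /negbFE/eqP.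
Qed.

Definition act_on (K : (X -> Y) -> X -> Y) U g : Smap E X Y :=
  fun t => if `[< U t >] then K (g t) else (fun _ => y0).

Lemma restr_act K U g : U `<=` simplex E ->
  restr y0 U (act_on K (simplex E) g) = act_on K U (restr y0 U g).
Proof.
move=> US; apply/funext => t; rewrite /restr /act_on.
by case: asboolP => // Ut; case: asboolP => // -[]; exact: US.
Qed.

Lemma act_glued K A w phi : layout A ->
  act_on K (layout_space A) (glued A w phi) =
  glued A (fun i => act_on K (simplex E) (w i)) phi.
Proof.
move=> lA; apply/funext => t; rewrite /act_on; case: asboolP => At; last first.
  by rewrite glued_out.
have [F FA Ft] := At; rewrite !(glued_face _ _ lA FA Ft).
by case: asboolP => // -[]; exact: (layout_space_simplex At).
Qed.

(** For the empty layout the combining product is [1] at the constant map, being an empty product,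
    whereas a combination without terms is [0]. This supplies the default index for [comb_lc]. *)
Lemma fissile_inhabited n w : fissile y0 (lc n w) -> inhabited I.
Proof.
move=> fis; have l0 : layout (finset.set0 : {set {set E}}).
  by split=> F; rewrite ?finset.in_set0 // => G; rewrite finset.in_set0.
have := congr1 (fun h => h (fun _ _ => y0)) (fis _ l0).
rewrite push_lc /comb; case: asboolP => [_|[]]; last first.
  by apply/funext => t; rewrite /restr; case: ifP.
rewrite big_set0 => /eqP; apply: contraTP => NI; rewrite /lc big_pred0 //.
by move=> i; case: NI; exists.
Qed.

(** Acting pointwise commutes with restriction and with gluing, so the new fissility identity is a
    push-forward of the old one. *)
Lemma fissile_act n w K : fissile y0 (lc n w) ->
  fissile y0 (lc n (fun i => act_on K (simplex E) (w i))).
Proof.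
move=> fis A lA; have [i0] := fissile_inhabited fis.
have EF (w' : I -> Smap E X Y) : (fun F : {set E} => push (restr y0 (face F)) (lc n w')) =
    (fun F => lc n (fun i => restr y0 (face F) (w' i))).
  by apply/funext => F; rewrite push_lc.
have := fis A lA; rewrite !EF !push_lc !(comb_lc _ _ i0) //.
move=> /(congr1 (push (act_on K (layout_space A)))); rewrite !push_lc => h.
transitivity (lc n (fun i => act_on K (layout_space A)
  (restr y0 (layout_space A) (w i)))).
  by congr lc; apply/funext => i; rewrite restr_act //; exact: layout_space_simplex.
by rewrite h; congr lc; apply/funext => phi; exact: act_glued.
Qed.

End layouts.

(* Neither [k] nor [phi] has to be continuous. *)
Definition locop {X Y : Type} (k : X -> Y -> Y) (phi : X -> X) (f : X -> Y) : X -> Y :=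
  fun x => k x (f (phi x)).

Lemma pcomp_bmap {X Y : topologicalType} (x0 : X) (y0 : Y) a f :
  Defs.pcomp x0 y0 a f -> bmap x0 y0 f.
Proof.
by move=> [gam [_ gb _ <-]]; apply: gb; rewrite /unit_interval /= ler01 lexx.
Qed.

(** The operator may be chosen after [E] and after the finitely many maps in the combination, which
    makes room for compactness arguments. *)
Lemma strong_sim_locop {X Y : topologicalType} (x0 : X) (y0 : Y) r
    (a b a' b' : X -> Y) :
  bmap x0 y0 b -> bmap x0 y0 b' -> strong_sim x0 y0 r a b ->
  (forall (E J : finType) (g : J -> Smap E X Y),
    (forall j, maps_on y0 (simplex E) (Defs.pcomp x0 y0 a) (g j)) ->
    exists k phi, locop k phi b = b' /\ forall j,
      maps_on y0 (simplex E) (Defs.pcomp x0 y0 a')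
        (act_on y0 (locop k phi) (simplex E) (g j))) ->
  strong_sim x0 y0 r a' b'.
Proof.
move=> [_ bx0] bb' sim loc E E0; have [S [fS fisS filS]] := sim E E0.
have [J [n [g [ES gS]]]] := finite_fsupp_lcE fS.
have [k [phi [kb kg]]] := loc E J g gS.
set K := act_on y0 (locop k phi) (simplex E) in kg.
rewrite ES in fisS filS; exists (lc n (fun j => K (g j))); split.
- exact: freeab_lc.
- exact: fissile_act.
have KXi : K (Xi y0 b) = Xi y0 b'.
  by apply/funext => t; rewrite /K /act_on /Xi; case: asboolP.
have EV : (fun h => gen (Xi y0 b') h - lc n (fun j => K (g j)) h) =
    push K (fun h => gen (Xi y0 b) h - lc n g h).
  rewrite !gen_sub_lc push_lc; congr lc; apply/funext => -[i|j] //=.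
rewrite EV; split.
  rewrite -EV gen_sub_lc; apply: freeab_lc => -[_|j].
    split.
    - apply/ctsOnP/(eq_ctsOn _ (@ctsOn_cst _ _ _ (b' : compact_open))) => t.
      by rewrite inE /Xi => St; case: asboolP.
    - by move=> t St; rewrite /Xi; case: asboolP.
    - by move=> t St; rewrite /Xi; case: asboolP.
  have [c1 c2 c3] := kg j; split => // t St; apply: pcomp_bmap; exact: c2 St.
move=> R Rs Rr.
(* The image of [R] under [phi] on the second factor, without the points that land on the base
   point; it is not larger than [R]. *)
pose R' := seq_fset tt [seq q <- [seq (p.1, phi p.2) | p <- R] | q.2 != x0].
(* [Psi] recovers the restriction of the new map to [R] from that of the old one to [R']; at the
   discarded points the old map, being based, has value [y0]. *)
pose Psi (f : {ptws E -> RR} * X -> Y) p :=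
  if p \in R then k p.2 (if phi p.2 == x0 then y0 else f (p.1, phi p.2)) else y0.
have := filS.2 R'; rewrite gen_sub_lc !push_lc => filR'.
have -> : (fun o : 'I_1 + J => wr_restr y0 R (K (if o is inr i then g i else Xi y0 b))) =
    (fun o => Psi (wr_restr y0 R' (if o is inr i then g i else Xi y0 b))).
  apply/funext => o; apply/funext => -[t x]; rewrite /wr_restr /Psi.
  case: ifPn => // tR; have [/= St _] := Rs _ tR.
  rewrite /K /act_on /= asboolT // /locop; congr k.
  have [->|px] := eqVneq (phi x) x0.
    case: o => [_|j]; first by rewrite /Xi asboolT.
    by have [_ /(_ t St) /pcomp_bmap[]] := gS j.
  rewrite ifT // seq_fsetE mem_filter /= px /=.
  by apply/mapP; exists (t, x).
rewrite -[LHS](push_lc _ _ Psi) -(push_lc _ _ (wr_restr y0 R')) push_lc filR'.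
- by apply/funext => w; rewrite /push fsbig1.
- move=> q; rewrite seq_fsetE mem_filter => /andP[px /mapP[p pR qE]].
  by rewrite qE /= in px *; split => //; case: (Rs _ pR).
- apply: leq_trans Rr; rewrite size_seq_fset (leq_trans (size_undup _)) //.
  by rewrite size_filter (leq_trans (count_size _ _)) // size_map.
Qed.

(** * Homotopies and paths of maps *)

(** The tube lemma: compactness of [K] gives one neighbourhood of [t] that works for all points of
    [K]. *)
Lemma curry_ctsOn {T X Y : topologicalType} (U : set T) (F : T * X -> Y) :
  ctsOn (U `*` setT) F ->
  ctsOn U (fun t => (fun x => F (t, x)) : {compact-open, X -> Y}).
Proof.
move=> cF t Ut; apply/compact_open_cvgP => K O cK oO FKO.
rewrite nbhs_simpl /= /within /=.
have : \forall s \near t, K `<=` (fun x => U s -> O (F (s, x))).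
  move: (K) cK FKO => {}K /compact_near_coveringP NC FKO.
  apply: NC => x Kx.
  have Otx : O (F (t, x)) by apply: FKO; exists x.
  have /= := cF (t, x) (conj Ut I) O (open_nbhs_nbhs (conj oO Otx)).
  rewrite !nbhs_simpl /= /within /= => -[[P Q] /= [nP nQ] PQ].
  by exists (Q, P) => // -[x' s] /= [Qx' Ps] Us; exact: (PQ (s, x')).
by apply: filterS => s KO Us _ [x Kx <-]; exact: KO.
Qed.

(** By regularity, each point of [X] has a compact neighbourhood that [g t] sends into the given
    open set, and this condition is open in the compact-open topology. *)
Lemma uncurry_ctsOn {T X Y : topologicalType} (U : set T)
    (g : T -> {compact-open, X -> Y}) :
  hausdorff_space X -> compact [set: X] -> ctsOn U g ->
  (forall t, U t -> continuous (g t : X -> Y)) ->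
  ctsOn (U `*` setT) (fun q => g q.1 q.2).
Proof.
move=> hX cX cg cgt [t x] [/= Ut _] P; rewrite nbhsE => -[ O [oO Otx] OP].
rewrite nbhs_simpl /= /within /=.
have nO : nbhs x (g t @^-1` O) by apply: cgt => //; exact: open_nbhs_nbhs.
have [R nR RO] := compact_regular hX cX (@filterT _ _ (nbhs_filter x)) nO.
have cR : compact (closure R).
  exact: subclosed_compact (@closed_closure _ _) cX _.
have := cg t Ut; move/compact_open_cvgP => /(_ (closure R) O cR oO).
rewrite nbhs_simpl /= /within /= => /(_ _) H.
have {}H : \forall s \near t, U s -> g s @` closure R `<=` O.
  by apply: H => _ [z Rz <-]; exact: RO.
exists ([set s | U s -> g s @` closure R `<=` O], R) => //= -[s z] /= [HO Rz] [Us _].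
by apply: OP; apply: HO => //; exists z => //; exact: subset_closure.
Qed.

Lemma ctsOn_swap {T U Y : topologicalType} (A : set T) (B : set U) (F : T * U -> Y) :
  ctsOn (A `*` B) F -> ctsOn (B `*` A) (fun q => F (q.2, q.1)).
Proof.
move=> cF; apply: (ctsOn_comp _ _ (fun q : U * T => (q.2, q.1)) F _ cF).
  by apply: ctsOn_pair; [apply: ctsOn_snd|apply: ctsOn_fst]; exact: ctsOn_id.
by move=> q [].
Qed.

Lemma bhomotopicP {X Y : topologicalType} (x0 : X) (y0 : Y) a b :
  bhomotopic x0 y0 a b <-> homot y0 setT [set x0] a b.
Proof.
split=> -[H [cH H0 H1 Hx0]]; exists H; split => //.
- exact/ctsOnP.
- by move=> _ t ->; exact: Hx0.
- exact/ctsOnP.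
- by move=> x; rewrite H0.
- by move=> x; rewrite H1.
- by move=> t; exact: Hx0.
Qed.

Lemma bhomotopic_trans {X Y : topologicalType} (x0 : X) (y0 : Y) a b c :
  bhomotopic x0 y0 a b -> bhomotopic x0 y0 b c -> bhomotopic x0 y0 a c.
Proof.
move=> /bhomotopicP ab /bhomotopicP bc; apply/bhomotopicP.
exact: homot_trans ab bc.
Qed.

Lemma bhomotopic_sym {X Y : topologicalType} (x0 : X) (y0 : Y) a b :
  bhomotopic x0 y0 a b -> bhomotopic x0 y0 b a.
Proof.
have sub t : unit_interval t -> unit_interval (1 - t).
  by move=> /andP[t0 t1]; apply/andP; split; lra.
move=> [H [/ctsOnP cH H0 H1 Hx0]].
exists (fun q => H (q.1, 1 - q.2)); split.
- apply/ctsOnP/(ctsOn_comp _ _ (fun q : X * RR => (q.1, 1 - q.2)) H _ cH).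
    apply: ctsOn_pair; first by apply: ctsOn_fst; exact: ctsOn_id.
    by apply: ctsOn_cstB; apply: ctsOn_snd; exact: ctsOn_id.
  by move=> q [_ Iq]; split => //; exact: sub.
- by move=> x; rewrite subr0.
- by move=> x; rewrite subrr.
- by move=> t It; apply: Hx0; exact: sub.
Qed.

(** The exponential law: for [X] compact Hausdorff, paths of based maps are based homotopies. *)
Lemma pcompP {X Y : topologicalType} (x0 : X) (y0 : Y) a b :
  hausdorff_space X -> compact [set: X] ->
  Defs.pcomp x0 y0 a b <-> bhomotopic x0 y0 a b.
Proof.
move=> hX cX; split.
  move=> [gam [/ctsOnP cgam gb g0 g1]].
  exists (fun q => gam q.2 q.1); split.
  - apply/ctsOnP; apply: (@ctsOn_swap _ _ _ _ _ (fun q => gam q.1 q.2)).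
    by apply: uncurry_ctsOn => // t /gb[].
  - by move=> x /=; rewrite g0.
  - by move=> x /=; rewrite g1.
  - by move=> t /gb[].
move=> [H [/ctsOnP cH H0 H1 Hx0]]; exists (fun t x => H (x, t)); split.
- by apply/ctsOnP; apply: (@curry_ctsOn _ _ _ _ (fun q => H (q.2, q.1)));
    exact: ctsOn_swap.
- move=> t It; split; last exact: Hx0.
  apply: ctsOnT; apply: (ctsOn_comp _ _ (fun x => (x, t)) H _ cH) => //.
  by apply: ctsOn_pair; [exact: ctsOn_id|exact: ctsOn_cst].
- by apply/funext => x; rewrite H0.
- by apply/funext => x; rewrite H1.
Qed.

(** * The comultiplication *)

Section comultiplication.
Context {X Y : topologicalType} (x0 : X) (y0 : Y) (mu : X -> wedge2 x0).
Hypothesis hX : hausdorff_space X.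
Hypothesis cmu : continuous mu.
Hypothesis mux0 : mu x0 = wedge2_pt x0.

(** The retraction of the wedge onto the summand [b], which collapses the other summand. *)
Let pr (b : bool) : wedge2 x0 -> X :=
  wedge_fun (fun i : bool => if i == b then id else (fun=> x0)).

Let pr_compat (b i j : bool) : (if i == b then id else fun=> x0) x0 =
  (if j == b then id else fun=> x0) x0 :> X.
Proof. by case: ifP; case: ifP. Qed.

Let pr_continuous b : continuous (pr b).
Proof.
apply: wedge_fun_continuous; last exact: pr_compat.
by move=> i; case: ifP => _ x; [exact: cvg_id|exact: cvg_cst].
Qed.

Definition mu1 x := pr true (mu x).
Definition mu2 x := pr false (mu x).

Let wedge_cases (z : wedge2 x0) : exists i x,
  z = @wedge_lift bool (fun=> X) (fun=> x0) i x.
Proof.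
have : [set: wedge2 x0] z by [].
by rewrite -wedgeTE => -[i _ [x _ <-]]; exists i, x.
Qed.

Lemma mu12_base x : mu1 x = x0 \/ mu2 x = x0.
Proof.
rewrite /mu1 /mu2; have [i [x' ->]] := wedge_cases (mu x).
rewrite /pr !wedge_lift_funE; try exact: pr_compat.
by case: i; [right|left].
Qed.

(** In this form, left multiplication by [a] is visibly a local operator, which reads [b] at
    [mu2 x]. *)
Lemma mulmE (a b : X -> Y) : a x0 = y0 -> b x0 = y0 ->
  mulm mu a b = fun x => if mu2 x == x0 then a (mu1 x) else b (mu2 x).
Proof.
move=> a0 b0; apply/funext => x; rewrite /mulm /mu1 /mu2 /wsum /=.
have [i [x' ->]] := wedge_cases (mu x).
rewrite /pr !wedge_lift_funE; try exact: pr_compat.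
  by case: i => /=; [rewrite eqxx|case: eqP => [->|//]; rewrite a0 b0].
by move=> [] [] //=; rewrite a0 b0.
Qed.

Let cmu1 : continuous mu1.
Proof.
move=> x; apply: (@continuous_comp _ _ _ mu (pr true)); first exact: cmu.
exact: pr_continuous.
Qed.

Let cmu2 : continuous mu2.
Proof.
move=> x; apply: (@continuous_comp _ _ _ mu (pr false)); first exact: cmu.
exact: pr_continuous.
Qed.

Lemma mu1_base : mu1 x0 = x0.
Proof. by rewrite /mu1 mux0 /pr wedge_lift_funE //; exact: pr_compat. Qed.

Lemma mu2_base : mu2 x0 = x0.
Proof. by rewrite /mu2 mux0 /pr wedge_lift_funE //; exact: pr_compat. Qed.

(** The closed sets [mu1 = x0] and [mu2 = x0] cover [X]; on each of them a single formula is valid,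
    since [F] and [G] agree at the base point. *)
Lemma ctsOn_mulm {T : topologicalType} (U : set T) (F G : T * X -> Y) :
  ctsOn (U `*` setT) F -> ctsOn (U `*` setT) G ->
  (forall t, U t -> F (t, x0) = y0) -> (forall t, U t -> G (t, x0) = y0) ->
  ctsOn (U `*` setT)
    (fun q => if mu2 q.2 == x0 then F (q.1, mu1 q.2) else G (q.1, mu2 q.2)).
Proof.
move=> cF cG F0 G0.
have c1 : closed [set x0].
  exact/accessible_closed_set1/hausdorff_accessible.
have cfst A : ctsOn A (fun q : T * X => q.1) by apply: ctsOn_fst; exact: ctsOn_id.
have csnd A : ctsOn A (fun q : T * X => q.2) by apply: ctsOn_snd; exact: ctsOn_id.
apply: (@ctsOn_glue _ _ _ _ (fun q => (mu1 q.2, mu2 q.2))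
  [set p | p.1 = x0] [set p | p.2 = x0]).
- by apply: ctsOn_pair; apply: ctsOn_compT.
- apply: (@preimage_closed _ _ (fst : X * X -> X) [set x0]) => //.
  by move=> p _; exact: cvg_fst.
- apply: (@preimage_closed _ _ (snd : X * X -> X) [set x0]) => //.
  by move=> p _; exact: cvg_snd.
- by move=> q _; exact: mu12_base.
- apply: (@eq_ctsOn _ _ _ (fun q => G (q.1, mu2 q.2))).
    move=> [t x]; rewrite inE => -[[/= Ut _] m1]; case: eqP => // m2.
    by rewrite m1 m2 F0 ?G0.
  apply: (ctsOn_comp _ _ (fun q : T * X => (q.1, mu2 q.2)) G _ cG).
    by apply: ctsOn_pair => //; exact: ctsOn_compT.
  by move=> q [[]].
- apply: (@eq_ctsOn _ _ _ (fun q => F (q.1, mu1 q.2))).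
    by move=> [t x]; rewrite inE => -[[/= Ut _] m2]; rewrite m2 eqxx.
  apply: (ctsOn_comp _ _ (fun q : T * X => (q.1, mu1 q.2)) F _ cF).
    by apply: ctsOn_pair => //; exact: ctsOn_compT.
  by move=> q [[]].
Qed.

Lemma bmap_mulm a b : bmap x0 y0 a -> bmap x0 y0 b -> bmap x0 y0 (mulm mu a b).
Proof.
move=> [ca a0] [cb b0]; split; last first.
  by rewrite mulmE // mu2_base eqxx mu1_base.
move=> x; apply: (@continuous_comp _ _ _ mu (wsum x0 a b)); first exact: cmu.
by apply: wedge_fun_continuous => [[]//|[] []]; rewrite ?a0 ?b0.
Qed.

Lemma bhomotopic_mulm a a' b b' : bhomotopic x0 y0 a a' -> bhomotopic x0 y0 b b' ->
  bhomotopic x0 y0 (mulm mu a b) (mulm mu a' b').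
Proof.
have I0 : unit_interval 0 by rewrite /unit_interval /= lexx ler01.
have I1 : unit_interval 1 by rewrite /unit_interval /= lexx ler01.
move=> [F [/ctsOnP cF F0 F1 Fx0]] [G [/ctsOnP cG G0 G1 Gx0]].
exists (fun q => if mu2 q.1 == x0 then F (mu1 q.1, q.2) else G (mu2 q.1, q.2)); split.
- apply/ctsOnP; apply: (@ctsOn_swap _ _ _ _ _ (fun q : RR * X =>
    if mu2 q.2 == x0 then F (mu1 q.2, q.1) else G (mu2 q.2, q.1))).
  by apply: (@ctsOn_mulm _ _ (fun q => F (q.2, q.1)) (fun q => G (q.2, q.1))) => //;
    exact: ctsOn_swap.
- by move=> x /=; rewrite mulmE ?F0 ?G0 // -?F0 -?G0 ?Fx0 ?Gx0.
- by move=> x /=; rewrite mulmE ?F1 ?G1 // -?F1 -?G1 ?Fx0 ?Gx0.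
- by move=> t It /=; rewrite mu2_base eqxx mu1_base Fx0.
Qed.

End comultiplication.

(** * Homotopy invariance *)

Lemma simplex_compact (E : finType) : compact (simplex E).
Proof.
have cproj (e : E) : continuous (fun t : {ptws E -> RR} => t e).
  by move=> t; exact: proj_continuous.
apply: (@subclosed_compact _ _ [set t : {ptws E -> RR} | forall e, `[0, 1]%classic (t e)]).
- have -> : simplex E = \bigcap_(e in [set: E]) [set t : {ptws E -> RR} | 0 <= t e] `&`
      [set t : {ptws E -> RR} | \sum_(e : E) t e = 1].
    by apply/seteqP; split=> t [t0 t1]; split => // e *; exact: t0.
  apply: closedI.
    apply: closed_bigI => e _.
    apply: (@preimage_closed _ _ (fun t : {ptws E -> RR} => t e) [set s | 0 <= s]).
      by move=> t _; exact: cproj.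
    exact: closed_ge.
  apply: (@preimage_closed _ _ (fun t : {ptws E -> RR} => \sum_(e : E) t e : RR) [set 1]).
    move=> t _; apply: ctsOnT; apply: ctsOn_sum => e.
    exact: continuous_ctsOn.
  by apply: accessible_closed_set1; apply: hausdorff_accessible; exact: Rhausdorff.
- by apply: (@tychonoff E (fun=> RR) (fun=> `[0, 1]%classic)) => e; exact: segment_compact.
- move=> t [t0 t1] e /=; rewrite in_itv /= t0 /= -t1 (bigD1 e) //= lerDl.
  by apply: sumr_ge0.
Qed.

Section strong_similarity.
Context {X Y : topologicalType} (x0 : X) (y0 : Y) (r : nat).
Hypothesis hX : hausdorff_space X.
Hypothesis cX : compact [set: X].

(** The first map enters the relation only through its path component, which homotopic maps
    share. *)
Lemma strong_sim_homot_l a a' b : bhomotopic x0 y0 a a' ->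
  strong_sim x0 y0 r a b -> strong_sim x0 y0 r a' b.
Proof.
move=> aa' sim E E0; have [S [[fS SP] fis fil]] := sim E E0.
exists S; split => //; split => // g /SP [cg gP g0]; split => // t St.
have /pcompP ag := gP t St; apply/pcompP => //.
exact: bhomotopic_trans (bhomotopic_sym aa') (ag hX cX).
Qed.

Lemma maps_on_ctsOn {E : finType} a (g : Smap E X Y) :
  maps_on y0 (simplex E) (Defs.pcomp x0 y0 a) g ->
  ctsOn (simplex E `*` setT) (fun q => g q.1 q.2).
Proof.
by move=> [/ctsOnP cg gP _]; apply: uncurry_ctsOn => // t /gP /pcomp_bmap[].
Qed.

Lemma maps_on_act {E : finType} a K (g : Smap E X Y) :
  ctsOn (simplex E `*` setT) (fun q => K (g q.1) q.2) ->
  (forall t, simplex E t -> bhomotopic x0 y0 a (K (g t))) ->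
  maps_on y0 (simplex E) (Defs.pcomp x0 y0 a) (act_on y0 K (simplex E) g).
Proof.
move=> cK hK; split.
- apply/ctsOnP; apply: eq_ctsOn (curry_ctsOn cK) => t; rewrite inE => St.
  by rewrite /act_on asboolT.
- by move=> t St; rewrite /act_on asboolT //; apply/pcompP => //; exact: hK.
- by move=> t St; rewrite /act_on asboolF.
Qed.

Lemma strong_sim_mulm (mu : X -> wedge2 x0) a b c : continuous mu ->
  mu x0 = wedge2_pt x0 -> bmap x0 y0 a -> bmap x0 y0 b -> bmap x0 y0 c ->
  strong_sim x0 y0 r a b -> strong_sim x0 y0 r (mulm mu c a) (mulm mu c b).
Proof.
move=> cmu mux0 [ca a0] [cb b0] [cc c0] sim.
pose k x y := if mu2 mu x == x0 then c (mu1 mu x) else y.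
have kE f : f x0 = y0 -> locop k (mu2 mu) f = mulm mu c f.
  by move=> f0; rewrite (mulmE mu c0 f0).
apply: (@strong_sim_locop _ _ _ _ _ a b) => //; first exact: bmap_mulm.
move=> E J g gP; exists k, (mu2 mu); split => [|j]; first exact: kE.
have gb t : simplex E t -> bmap x0 y0 (g j t).
  by move=> St; have [_ /(_ t St) /pcomp_bmap] := gP j.
apply: maps_on_act.
  apply: (@ctsOn_mulm _ _ _ y0 _ hX cmu _ _ (fun q => c q.2) (fun q => g j q.1 q.2)) => //.
  - by apply: ctsOn_compT => //; apply: ctsOn_snd; exact: ctsOn_id.
  - exact: (maps_on_ctsOn (gP j)).
  - by move=> t /gb[].
move=> t St; rewrite kE; last by have [] := gb t St.
apply: bhomotopic_mulm => //.
  exists (fun q => c q.1); split => //; apply/ctsOnP.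
  by apply: ctsOn_compT => //; apply: ctsOn_fst; exact: ctsOn_id.
by have [_ /(_ t St) /pcompP ag _] := gP j; exact: (ag hX cX).
Qed.

Lemma strong_sim_homot_r a b b' : is_based_CW Y y0 ->
  bmap x0 y0 b -> bmap x0 y0 b' -> bhomotopic x0 y0 b b' ->
  strong_sim x0 y0 r a b -> strong_sim x0 y0 r a b'.
Proof.
move=> CWY bb bb' hbb' sim; have [cb b0] := bb.
apply: (@strong_sim_locop _ _ _ _ _ a b) => // E J g gP.
(* [C] is compact because [J] is finite, so all values that matter lie in one set [L] whose
   projections are homotopic near the diagonal. *)
pose C := (\bigcup_(j in [set: J])
  ((fun q => g j q.1 q.2) @` (simplex E `*` setT))) `|` (b @` setT).
have cC : compact C.
  apply: compactU; last by apply: ctsOn_compact => //; exact: continuous_ctsOn.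
  rewrite -fsbig_setU; last exact: finite_finset.
  rewrite fsbig_finite; last exact: finite_finset.
  apply: bigsetU_compact => j _; apply: ctsOn_compact.
    exact: (maps_on_ctsOn (gP j)).
  by apply: compact_setX => //; exact: simplex_compact.
have [L [CL cL [eps [ceps eps0 hlam]]]] := based_CW_proj_homotopic CWY cC.
have Lb x : L (b x) by apply: CL; right; exists x.
have Lg j t x : simplex E t -> L (g j t x).
  by move=> St; apply: CL; left; exists j => //; exists (t, x).
have Ly0 : L y0 by rewrite -b0.
pose S : set (X * Y) := [set p | L p.2 /\ eps (p.2, b p.1) < 1].
have cp1 A : ctsOn A (fun p : X * Y => p.1) by apply: ctsOn_fst; exact: ctsOn_id.
have cp2 A : ctsOn A (fun p : X * Y => p.2) by apply: ctsOn_snd; exact: ctsOn_id.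
have cdiag A : ctsOn A (fun p : X * Y => (p.2, b p.1)).
  by apply: ctsOn_pair => //; exact: ctsOn_compT.
have : homot y0 S [set (x0, y0)] (fun p => p.2) (fun p => b' p.1).
  apply: (@homot_trans _ _ _ _ _ _ (fun p => b p.1)).
    apply: (@homot_comp _ _ _ _ _ _ _ _ (fun p : X * Y => (p.2, b p.1))) hlam => //.
    - by move=> p [Lp ep]; split => //; split => //=; exact: Lb.
    - by move=> _ -> /=; rewrite b0.
  move/bhomotopicP: hbb'; apply: homot_comp => //.
  by move=> _ ->.
move=> [Q [cQ Q0 Q1 QB]].
pose e (p : X * Y) : RR := eps (p.2, b p.1).
(* The motion is complete for [e <= 1/4] and absent for [e >= 1/2]. *)
pose k (q : X * Y * RR) := if 2^-1 <= e q.1 then q.1.2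
  else Q (q.1, q.2 * clamp (2 - 4 * e q.1)).
have ce : ctsOn [set p | L p.2] e.
  apply: (ctsOn_comp _ _ (fun p : X * Y => (p.2, b p.1)) eps _ ceps) => //.
  by move=> p Lp; split => //=; exact: Lb.
have ck : ctsOn ([set p | L p.2] `*` unit_interval) k.
  have cq1 A : ctsOn A (fun q : X * Y * RR => q.1) by apply: ctsOn_fst; exact: ctsOn_id.
  have ceq : ctsOn ([set p | L p.2] `*` unit_interval) (fun q => e q.1).
    by apply: (ctsOn_comp _ _ (fun q : X * Y * RR => q.1) e _ ce) => // q [].
  apply: ctsOn_if => //.
  - exact: ctsOn_cst.
  - by apply: ctsOn_snd.
  - apply: (ctsOn_comp _ _ (fun q : X * Y * RR =>
      (q.1, q.2 * clamp (2 - 4 * e q.1))) Q _ cQ).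
      apply: (@ctsOnW _ _ _ ([set p | L p.2] `*` unit_interval)); first exact: subIsetl.
      apply: ctsOn_pair => //; apply: ctsOnM.
        by apply: ctsOn_snd; exact: ctsOn_id.
      by apply: ctsOn_clamp; apply: ctsOn_cstB; exact: ctsOn_cstM.
    move=> [p s] [[/= Lp /andP[s0 s1]] ep]; split => /=.
      by split => //; apply: le_lt_trans ep _; lra.
    have /andP[cl0 cl1] := clamp_itv (2 - 4 * e p).
    by apply/andP; split; [exact: mulr_ge0|exact: mulr_ile1].
  - move=> [p s] [/= Lp Is] ep; rewrite -ep.
    rewrite (@clamp_eq0 (2 - 4 * 2^-1)) ?mulr0 ?Q0 //; last by lra.
    by split => //; rewrite -[eps _]/(e p) -ep; lra.
have k0 p : L p.2 -> k (p, 0) = p.2.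
  move=> Lp; rewrite /k /=; case: ifPn => //; rewrite -ltNge => ep.
  by rewrite mul0r Q0 //; split => //; apply: lt_trans ep _; lra.
have kx0 s : unit_interval s -> k ((x0, y0), s) = y0.
  move=> /andP[s0 s1]; rewrite /k /e /= b0 eps0 // ifF; last by apply/negbTE; rewrite -ltNge; lra.
  apply: QB => //; have /andP[cl0 cl1] := clamp_itv (2 - 4 * 0).
  by apply/andP; split; [exact: mulr_ge0|exact: mulr_ile1].
have I1 : unit_interval 1 by rewrite /unit_interval /= lexx ler01.
(* Time [1] gives the operator; the earlier times show that it keeps maps in the path component of
   [a]. *)
exists (fun x y => k ((x, y), 1)), id; split=> [|j].
  apply/funext => x; rewrite /locop /k /e /= eps0 // ifF; last first.
    by apply/negbTE; rewrite -ltNge; lra.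
  rewrite clamp_eq1; last by lra.
  by rewrite mulr1 Q1 //; split => //=; rewrite eps0 //; lra.
have gb t : simplex E t -> bmap x0 y0 (g j t).
  by move=> St; have [_ /(_ t St) /pcomp_bmap] := gP j.
apply: maps_on_act.
  apply: (ctsOn_comp _ _ (fun q : {ptws E -> RR} * X =>
    ((q.2, g j q.1 q.2), 1 : RR)) k _ ck).
    apply: ctsOn_pair; last exact: ctsOn_cst.
    apply: ctsOn_pair; first by apply: ctsOn_snd; exact: ctsOn_id.
    exact: (maps_on_ctsOn (gP j)).
  by move=> [t x] [/= St _]; split => //=; exact: Lg.
move=> t St; apply: (@bhomotopic_trans _ _ _ _ _ (g j t)).
  by have [_ /(_ t St) /pcompP ag _] := gP j; exact: (ag hX cX).
exists (fun q => k ((q.1, g j t q.1), q.2)); split.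
- apply/ctsOnP; apply: (ctsOn_comp _ _ (fun q : X * RR =>
    ((q.1, g j t q.1), q.2)) k _ ck).
    apply: ctsOn_pair; last by apply: ctsOn_snd; exact: ctsOn_id.
    apply: ctsOn_pair; first by apply: ctsOn_fst; exact: ctsOn_id.
    apply: ctsOn_compT; last by have [] := gb t St.
    by apply: ctsOn_fst; exact: ctsOn_id.
  by move=> q [_ Iq]; split => //=; exact: Lg.
- by move=> x; rewrite k0 //=; exact: Lg.
- by [].
- by move=> s Is /=; have [_ ->] := gb t St; exact: kx0.
Qed.

End strong_similarity.

(* [a] ~^r [b]  <->  [a]^-1 [b] = [(a o nu \bar\vee b) o mu] lies in
   [X,Y]^((r+1)) = { c | 1 ~^r c }. *)
Theorem theorem8p2 (X Y : topologicalType) (x0 : X) (y0 : Y)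
  (mu : X -> wedge2 x0) (nu : X -> X) (r : nat) :
  is_based_CW X x0 -> is_based_CW Y y0 -> compact [set: X] ->
  admissible x0 y0 mu nu ->
  forall a b : X -> Y, bmap x0 y0 a -> bmap x0 y0 b ->
  (strong_sim x0 y0 r a b <-> strong_sim x0 y0 r (fun _ => y0) (mulm mu (a \o nu) b)).
Proof.
move=> [hX _] CWY cX [[cmu mux0] [cnu nux0] grp] a b ba bb.
have ban : bmap x0 y0 (a \o nu).
  have [ca a0] := ba; split; last by rewrite /= nux0.
  by move=> x; apply: continuous_comp; [exact: cnu|exact: ca].
have b1 : bmap x0 y0 (fun _ => y0) by split => // x; exact: cvg_cst.
have bM f g : bmap x0 y0 f -> bmap x0 y0 g -> bmap x0 y0 (mulm mu f g).
  exact: bmap_mulm.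
split=> sim.
  (* Left multiplication by [a^-1] gives [a^-1 a ~ a^-1 b], and [a^-1 a] is homotopic to the
     constant map. *)
  have [_ _ _ aV _] := grp a b b ba bb bb.
  apply: (strong_sim_homot_l hX cX aV).
  exact: strong_sim_mulm.
(* Left multiplication by [a] gives [a 1 ~ a (a^-1 b)], which the group laws turn into [a ~ b]. *)
have [_ _ a1 _ aV] := grp a b b ba bb bb.
have [assoc _ _ _ _] := grp a (a \o nu) b ba ban bb.
have [_ u1 _ _ _] := grp b b b bb bb bb.
have anb : bmap x0 y0 (mulm mu (a \o nu) b) by exact: bM.
have := strong_sim_mulm hX cX cmu mux0 b1 anb ba sim.
move=> /(strong_sim_homot_l hX cX a1).
apply: strong_sim_homot_r => //; first exact: bM.
apply: bhomotopic_trans (bhomotopic_sym assoc) _.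
apply: bhomotopic_trans u1.
apply: bhomotopic_mulm => //.
exists (fun q => b q.1); split => //; last by move=> t _; case: bb.
by apply/ctsOnP/ctsOn_compT; [apply: ctsOn_fst; exact: ctsOn_id|case: bb].
Qed.
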